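(* For each $n$ let $\pi_n$ be a uniformly random parking function of length $n$, and let $K_n(\pi_n)$ be its number of cycles. Then $$\frac{K_n(\pi_n)-\frac12\log n}{\sqrt{\frac12\log n}}\longrightarrow \mathcal N(0,1)\quad\text{in distribution as } n\to\infty,$$ where $\mathcal N(0,1)$ is a standard normal random variable.
   Context: Let $[n]=\{1,\dots,n\}$. A parking function of length $n$ is a sequence $\pi_n=(\pi_n(1),\dots,\pi_n(n))\in[n]^n$ such that $|\{k\in[n]:\pi_n(k)\le i\}|\ge i$ for all $i\in[n]$. Viewing $\pi_n$ as a map $[n]\to[n]$, its digraph $G_{\pi_n}$ is the directed graph with vertex set $[n]$ and a directed edge from $i$ to $\pi_n(i)$ for every $i\in[n]$. The number of cycles $K_n(\pi_n)$ is the number of directed cycles in $G_{\pi_n}$ (a fixed point gives a self-loop, which counts as a cycle of length $1$). *)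

(* Defs.v *)
From HB Require Import structures.
From mathcomp Require Import all_boot all_order all_algebra.
From mathcomp Require Import all_classical all_reals all_analysis.

Set Implicit Arguments.
Unset Strict Implicit.
Unset Printing Implicit Defensive.

Import Order.TTheory GRing.Theory Num.Theory.
Import numFieldNormedType.Exports.

Local Open Scope classical_set_scope.
Local Open Scope ring_scope.

(* The label i of [n] = {1, ..., n} is encoded as the ordinal i - 1 : 'I_n, so
   the condition |{k : f k <= i}| >= i for i in [n] becomes
   |{k : f k <= i}| >= i + 1 for i : 'I_n. *)
Definition is_parking n (f : {ffun 'I_n -> 'I_n}) : bool :=
  [forall i : 'I_n, (i < #|[set k : 'I_n | (f k <= i)%N]%SET|)%N].

Record parking n := Parking {
  parking_fun :> {ffun 'I_n -> 'I_n};
  parkingP : is_parking parking_fun }.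

HB.instance Definition _ n := [isSub for @parking_fun n].
HB.instance Definition _ n := [Finite of parking n by <:].

Lemma is_parking_id n : is_parking [ffun i : 'I_n => i].
Proof.
apply/forallP => i; rewrite -[leqLHS](card_ord i.+1).
have w_inj : injective (widen_ord (ltn_ord i)).
  by move=> j k /(congr1 val)/= jk; exact: val_inj.
rewrite -(card_codom w_inj) subset_leq_card//.
apply/fintype.subsetP => _ /codomP[j ->].
by rewrite inE ffunE/= -ltnS.
Qed.

(* Measurable types are pointed. *)
HB.instance Definition _ n := isPointed.Build (parking n)
  (Parking (is_parking_id n)).

(* Every subset of the finite set of parking functions is measurable. *)
HB.instance Definition _ n := @isMeasurable.Build default_measure_display
  (parking n) discrete_measurable discrete_measurable0
  discrete_measurableC discrete_measurableU.

(* The edges x -> next s x, for x in s, of the closed walk through the vertices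
   of s taken in cyclic order. *)
Definition cycle_edges (T : finType) (s : seq T) : {set T * T} :=
  [set (x, next s x) | x in s]%SET.

(* A directed cycle is a subgraph, given by its set of edges, so cyclic
   sequences of vertices that agree up to rotation are the same cycle.  A loop
   [:: x] with e x x is a cycle of length 1. *)
Definition is_dicycle (T : finType) (e : rel T) (C : {set T * T}) : Prop :=
  exists s : seq T, [/\ s != [::], uniq s, cycle e s & C = cycle_edges s].

Definition ndicycles (T : finType) (e : rel T) : nat :=
  #|[set C : {set T * T} | `[< is_dicycle e C >]]%SET|.

Definition digraph_of n (f : {ffun 'I_n -> 'I_n}) : rel 'I_n :=
  [rel i j | j == f i].

Definition ncycles n (f : {ffun 'I_n -> 'I_n}) : nat :=
  ndicycles (digraph_of f).

Definition normalized_ncycles (R : realType) n (f : parking n) : R :=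
  ((ncycles f)%:R - 2^-1 * ln n%:R) / Num.sqrt (2^-1 * ln n%:R).

Lemma measurable_normalized_ncycles (R : realType) n :
  measurable_fun [set: parking n] (@normalized_ncycles R n).
Proof. by []. Qed.

HB.instance Definition _ (R : realType) n :=
  isMeasurableFun.Build _ _ _ _ (@normalized_ncycles R n)
    (@measurable_normalized_ncycles R n).

Definition uniform_parking (R : realType) d (T : measurableType d)
    (P : probability T R) n (X : {RV P >-> parking n}) : Prop :=
  forall f : parking n,
    distribution P X [set f] = ((#|{: parking n}|%:R)^-1)%:E.

(* The random variables X n may live on different probability spaces; mu is the
   law of the limit, and y |-> mu `]-oo, y] its distribution function. *)
Definition cvg_in_distribution (R : realType) (d : nat -> measure_display)
    (T : forall n, measurableType (d n)) (P : forall n, probability (T n) R)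
    (X : forall n, {RV (P n) >-> R})
    (mu : probability (measurableTypeR R) R) : Prop :=
  forall x : R, {for x, continuous (fun y : R => mu `]-oo, y]%classic)} ->
    cdf (X n) x @[n --> \oo] --> mu `]-oo, x]%classic.

(* Main.v *)
Require Import Defs.
From HB Require Import structures.
From mathcomp Require Import all_boot all_order fingroup perm all_algebra.
From mathcomp Require Import zify ring lra.
From mathcomp Require Import boolp.

(** * Central limit theorem for the cycles of a uniform parking function

    The proof has an exact combinatorial half and an analytic half.

    Exact law.  A set S with f @: S = S is a union of cycles of f, so
      (1 + u) ^ K(f) = sum over such S of u ^ (number of cycles of f inside S)
    (sum_stable_sets).  Sum over all parking functions f.  Permuting the
    arguments of f preserves the parking condition, so every permutation of S
    is the restriction of equally many f, and the permutations of S contribute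
    the rising factorial u (u + 1) ... (u + |S| - 1) (sum_perm_cycles).  What
    remains is the number of parking functions that are injective on k given
    positions.  Pollak's circular argument computes it up to a factor: among the
    n + 1 rotations of a map into n + 1 places arranged on a circle exactly one
    is a parking function (unique_rotation), and rotations preserve
    injectivity.  The resulting proportion is
      survival n k = prod_(i < k) (1 - i / (n + 1)),
    and a summation by parts turns the identity into a mixture: K has the law of
    the number of cycles of a uniform permutation of C points, where C is
    random with P (C >= k) = survival n k for k <= n (sum_parking_ecycles).

    Asymptotics.  The number of cycles of a uniform permutation of c points is a
    sum of independent Bernoulli variables of parameters 1/1, ..., 1/c, hence
    close to a Poisson variable of mean H_c; this is used in the form of the
    approximate size-bias identity E [k g(k)] = H_c E [g(k + 1)] + O (sup of
    the increments of g) (ecycles_size_bias).  Moreover C is of order sqrt n,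
    so that the mean of |H_C - (ln n) / 2| is bounded (core_log_deviation).
    For W = (K - mu) / sigma with mu = sigma ^ 2 = (ln n) / 2 this gives
      E [W F(W)] = sigma E [F(W + 1 / sigma) - F(W)] + O (1 / sigma)
    for bounded Lipschitz F (eparking_stein), which is Stein's characterization
    of the normal law up to an error that tends to 0.

    Stein's equation F'(x) - x F(x) = q(x) is solved for Lipschitz q with
    compact support and normal mean 0; then F has compact support too, and all
    the bounds on F follow from compactness (stein_solution).  Taking for q a
    combination of two trapezoids, one around the interval of interest and one
    so wide that by tightness it captures almost all the mass of W, bounds the
    mass of W in an interval from below (interval_lower_bound).  Such bounds on
    intervals exhausting ]-oo, x] and ]x, +oo[ squeeze the distribution function
    of W. *)

Set Implicit Arguments.
Unset Strict Implicit.
Unset Printing Implicit Defensive.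

Import Order.TTheory GRing.Theory Num.Theory.

Local Open Scope ring_scope.

(** * Cycles of permutations *)

Section FunctionalGraph.
Variable T : finType.
Implicit Types (f : T -> T) (S : {set T}) (s : {perm T}).

Definition rising (A : comNzRingType) (u : A) k := \prod_(i < k) (u + i%:R).

(** A permutation supported in [S] fixes the points outside [S], each of which
    is an orbit by itself. *)
Lemma card_porbits_on S s : perm_on S s ->
  #|porbits s| = (#|porbit s @: S| + #|~: S|)%N.
Proof.
move=> sS.
have fixC x : x \notin S -> porbit s x = [set x]%SET.
  move=> xS; apply/setP => y; rewrite inE; apply/porbitP/eqP => [[i ->]|->].
    by rewrite permX; elim: i => //= i ->; exact: out_perm xS.
  by exists 0%N; rewrite perm1.
have -> : porbits s = (porbit s @: S :|: porbit s @: (~: S))%SET.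
  rewrite -imsetU setUCr; apply/setP => B.
  by apply/imsetP/imsetP => -[x _ ->]; exists x; rewrite ?inE.
rewrite cardsU (_ : _ :&: _ = set0)%SET ?cards0 ?subn0; last first.
  apply/setP => B; rewrite !inE; apply/negbTE/negP => /andP[].
  move=> /imsetP[x xS ->] /imsetP[y]; rewrite inE => yS xy.
  have := porbit_id s x; rewrite xy fixC// inE => /eqP exy.
  by rewrite exy (negbTE yS) in xS.
congr (_ + _)%N; apply: card_in_imset => x y; rewrite !inE => xS yS.
by rewrite !fixC// => /set1_inj.
Qed.

(** Since [s] fixes [x], composing with the transposition of [x] and [y] inserts
    [x] in the cycle of [y] when [y != x], and leaves [x] as a cycle of its own
    when [y = x]. *)
Lemma card_porbit_tperm S s x y : x \notin S -> perm_on S s ->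
  y \in (x |: S)%SET ->
  #|porbit (tperm x y * s)%g @: (x |: S)%SET| = (#|porbit s @: S| + (y == x))%N.
Proof.
move=> xS sS yS.
have sSx : perm_on (x |: S) s by apply: subset_trans sS _; exact: subsetUr.
have tSx : perm_on (x |: S) (tperm x y * s)%g.
  apply: perm_onM sSx; apply: subset_trans (tperm_on x y) _.
  by apply/subsetP => z /set2P[] ->//; rewrite setU11.
have /= := porbits_mul_tperm s x y.
rewrite (card_porbits_on tSx) (card_porbits_on sS).
have -> : #|~: S| = #|~: (x |: S)|.+1.
  rewrite (cardsD1 x (~: S)) inE xS; congr (_ + _)%N.
  by apply: eq_card => z; rewrite !inE negb_or.
have -> : (x \notin porbit s y) = (x != y).
  congr negb; rewrite porbit_sym; apply/porbitP/eqP => [[i ->]|->].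
    by rewrite permX; elim: i => //= i <-; rewrite (out_perm sS xS).
  by exists 0%N; rewrite perm1.
rewrite (eq_sym y x); case: (x == y) => /=; lia.
Qed.

(** Every permutation of [x |: S'] arises exactly once by inserting [x] in a
    permutation of [S'] just after some point [y]: the choice [y = x] opens a
    cycle and contributes [u], the [#|S'|] others contribute [1] each. *)
Lemma sum_perm_cycles (A : comNzRingType) (u : A) S :
  \sum_(s : {perm T} | perm_on S s) u ^+ #|porbit s @: S| = rising u #|S|.
Proof.
move: {2}#|S| (erefl #|S|) => k; elim: k S => [|k IH] S Sk.
  have S0 : S = set0 by apply/eqP; rewrite -cards_eq0 Sk.
  rewrite S0 cards0 /rising big_ord0 (big_pred1 1%g) ?imset0 ?cards0 ?expr0//.
  move=> s; apply/idP/eqP => [sS|->]; last exact: perm_on1.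
  by apply: perm_on_id sS _; rewrite cards0.
have /card_gt0P[x xS] : (0 < #|S|)%N by rewrite Sk.
pose S' := (S :\ x)%SET.
have S'k : #|S'| = k by have := cardsD1 x S; rewrite xS Sk => -[].
have xS' : x \notin S' by rewrite !inE eqxx.
have ES : S = (x |: S')%SET by rewrite setD1K.
(* The insertion point is the preimage of [x]. *)
rewrite (partition_big (fun s : {perm T} => (s^-1)%g x) (mem S)); last first.
  by move=> s sS /=; rewrite perm_closed//; exact: perm_onV.
rewrite Sk /rising big_ord_recr/= -[X in _ = X * _]/(rising u k) -S'k
  -(IH _ S'k).
transitivity (\sum_(y in S) \sum_(s : {perm T} | perm_on S' s)
    u ^+ (#|porbit s @: S'| + (y == x))).
  apply: eq_bigr => y yS.
  rewrite (reindex_onto (fun s => tperm x y * s)%g (fun s => tperm x y * s)%g);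
    last by move=> s _; rewrite tpermKg.
  have tS : perm_on S (tperm x y).
    apply: subset_trans (tperm_on x y) _.
    by apply/subsetP => z /set2P[] ->.
  have tsS s : perm_on S (tperm x y * s)%g = perm_on S s.
    apply/idP/idP => sS; last exact: perm_onM.
    by rewrite -(tpermKg x y s); exact: perm_onM.
  have tsx s : (((tperm x y * s)^-1)%g x == y) = (s x == x).
    rewrite invMg permM tpermV -(inj_eq (@perm_inj _ (tperm x y))) tpermK
      tpermR.
    by rewrite -(inj_eq (@perm_inj _ s)) permKV eq_sym.
  have on_S' s : perm_on S s && (s x == x) = perm_on S' s.
    apply/andP/idP => [[sS /eqP sx]|sS']; last first.
      by rewrite (out_perm sS' xS') eqxx; split; first exact: subset_trans sS'
        (subD1set _ _).
    apply/subsetP => z; rewrite !inE => sz; apply/andP; split.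
      by apply: contraNneq sz => ->; rewrite sx.
    by apply: (subsetP sS); rewrite inE.
  apply: eq_big => s; first by rewrite tpermKg eqxx andbT tsS tsx on_S'.
  rewrite tpermKg eqxx andbT tsS tsx on_S' => sS'.
  by rewrite ES card_porbit_tperm// -ES.
rewrite exchange_big/= mulr_suml; apply: eq_bigr => s sS'.
rewrite (bigD1 x)//= eqxx addn1 exprS mulrC mulrDr; congr (_ + _).
rewrite (eq_bigr (fun=> u ^+ #|porbit s @: S'|)); last first.
  by move=> y /andP[_ /negbTE ->]; rewrite addn0.
rewrite sumr_const mulr_natr; congr (_ *+ _).
by apply: eq_card => y; rewrite !inE andbC.
Qed.
End FunctionalGraph.

(** * Sets permuted by a self-map *)

Section VertexCycles.
Variable T : finType.
Implicit Types (f : T -> T) (S : {set T}) (s : {perm T}).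

Definition forward_orbit f x : {set T} := [set y | fconnect f x y]%SET.

Definition vertex_cycles f : {set {set T}} :=
  [set forward_orbit f x | x in [set x | fconnect f (f x) x]]%SET.

Lemma vertex_cyclesP f B :
  reflect (exists2 x, fconnect f (f x) x & B = forward_orbit f x)
    (B \in vertex_cycles f).
Proof.
apply: (iffP imsetP) => [[x]|[x xx ->]]; first by rewrite inE => ? ->; exists x.
by exists x; rewrite ?inE.
Qed.

(** A recurrent point can be reached back from every point of its orbit, so the
    forward orbits of recurrent points behave as equivalence classes. *)
Lemma forward_orbit_eq f x y : fconnect f (f x) x -> y \in forward_orbit f x ->
  forward_orbit f y = forward_orbit f x /\ fconnect f (f y) y.
Proof.
move=> xx; rewrite inE => xy.
have cx : fcycle f (orbit f x) by apply/(orbitPcycle 0 2).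
have inj_x : {in orbit f x &, injective f} by apply/injectivePcycle.
have yx : fconnect f y x.
  rewrite (fconnect_sym_in (@mem_orbit _ f x) inj_x) ?in_orbit//.
  by rewrite -fconnect_orbit.
split; first by apply/setP => z; rewrite !inE; apply/idP/idP;
  exact: connect_trans.
apply/(orbitPcycle 0 2).
apply/injectivePcycle => a b; rewrite -!fconnect_orbit => ya yb.
by apply: inj_x; rewrite -fconnect_orbit;
  apply: connect_trans xy _.
Qed.

Lemma vertex_cycles_disjoint f B C x :
  B \in vertex_cycles f -> C \in vertex_cycles f -> x \in B -> x \in C -> B = C.
Proof.
move=> /vertex_cyclesP[y yy ->] /vertex_cyclesP[z zz ->] xB xC.
by rewrite -(forward_orbit_eq yy xB).1 -(forward_orbit_eq zz xC).1.
Qed.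

Lemma vertex_cycle_neq0 f B : B \in vertex_cycles f -> exists x, x \in B.
Proof. by move=> /vertex_cyclesP[y _ ->]; exists y; rewrite inE. Qed.

Lemma vertex_cycle_stable f B : B \in vertex_cycles f -> (f @: B = B)%SET.
Proof.
move=> /vertex_cyclesP[x xx ->]; apply/setP => y; apply/imsetP/idP => [[z]|].
  by rewrite !inE => xz ->; apply: connect_trans xz _; exact: fconnect1.
move=> xy.
have [E yy] := forward_orbit_eq xx xy.
have /(orbitPcycle 2 3)[k /= <-] := yy.
 exists (iter k f y) => //.
by rewrite -E inE fconnect_iter.
Qed.

(** On a finite set a surjection is injective, so [f @: S = S] makes [f] a
    permutation of [S], which is extended here by the identity. *)
Lemma stable_permP f S : reflect
  (exists2 s, perm_on S s & {in S, f =1 s}) (f @: S == S)%SET.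
Proof.
apply: (iffP eqP) => [fS|[s sS fs]]; last first.
  by rewrite -[RHS](im_perm_on sS); apply: eq_in_imset.
have f_inj : {in S &, injective f}.
  by apply/imset_injP; rewrite fS.
have fin x : x \in S -> f x \in S by move=> xS; rewrite -fS imset_f.
pose g x := if x \in S then f x else x.
have g_inj : injective g.
  move=> x y; rewrite /g; case: ifPn => xS; case: ifPn => yS //.
  - exact: f_inj.
  - by move=> E; rewrite -E fin in yS.
  - by move=> E; rewrite E fin in xS.
exists (perm g_inj).
  by apply/subsetP => x; rewrite inE permE /g; case: ifP; rewrite ?eqxx.
by move=> x xS; rewrite permE /g xS.
Qed.

Lemma eq_perm_on S s t : perm_on S s -> perm_on S t -> {in S, s =1 t} -> s = t.
Proof.
move=> sS tS st; apply/permP => x; have [/st//|xS] := boolP (x \in S).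
by rewrite (out_perm sS)// (out_perm tS).
Qed.

Section Restricted.
Variables (f : T -> T) (S : {set T}) (s : {perm T}).
Hypotheses (sS : perm_on S s) (fs : {in S, f =1 s}).

Lemma perm_on_iter x k : x \in S -> iter k f x = (s ^+ k)%g x /\ iter k f x \in
  S.
Proof.
move=> xS; rewrite permX; elim: k => //= k [IH kS].
by rewrite (fs kS) IH; split=> //; rewrite perm_closed// -IH.
Qed.

Lemma forward_orbit_porbit x : x \in S -> forward_orbit f x = porbit s x.
Proof.
move=> xS; apply/setP => y; rewrite inE; apply/idP/porbitP => [|[k ->]].
  by move=> /iter_findex <-; exists (findex f x y);
    rewrite (perm_on_iter _ xS).1.
by rewrite -(perm_on_iter _ xS).1; exact: fconnect_iter.
Qed.

Lemma perm_on_recurrent x : x \in S -> fconnect f (f x) x.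
Proof.
move=> xS; apply/(orbitPcycle 2 3); exists #[s]%g.-1.
by rewrite (perm_on_iter _ xS).1 prednK ?order_gt0// expg_order perm1.
Qed.

Lemma forward_orbit_sub x : x \in S -> (forward_orbit f x \subset S)%SET.
Proof.
move=> xS; apply/subsetP => y; rewrite inE => /iter_findex <-.
exact: (perm_on_iter _ xS).2.
Qed.

(** Inside a set that [f] permutes every point is recurrent, and the orbits of
    [f] are those of the permutation. *)
Lemma vertex_cycles_within : (vertex_cycles f ::&: S = porbit s @: S)%SET.
Proof.
apply/setP => B; rewrite inE; apply/andP/imsetP => [[]|[x xS ->]].
  move=> /vertex_cyclesP[x xx ->] /subsetP BS.
  have xS : x \in S by apply: BS; rewrite inE.
  by exists x => //; exact: forward_orbit_porbit.
rewrite -forward_orbit_porbit//; split; last exact: forward_orbit_sub.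
by apply/vertex_cyclesP; exists x => //; exact: perm_on_recurrent.
Qed.
End Restricted.

Lemma cover_vertex_cycles f S : (f @: S == S)%SET ->
  cover (vertex_cycles f ::&: S) = S.
Proof.
move=> /stable_permP[s sS fs]; apply/setP => x; apply/bigcupP/idP.
  by move=> [B]; rewrite inE => /andP[_ /subsetP]; apply.
move=> xS; exists (forward_orbit f x); last by rewrite inE.
rewrite inE (forward_orbit_sub sS fs xS) andbT.
by apply/vertex_cyclesP; exists x => //; exact: perm_on_recurrent sS fs x xS.
Qed.

Lemma exp1D_powerset (A : comNzRingType) (I : finType) (u : A) (V : {set I}) :
  (1 + u) ^+ #|V| = \sum_(Q in powerset V) u ^+ #|Q|.
Proof.
rewrite addrC -prodr_const big_mkcond/=.
rewrite (eq_bigr (fun i => (if i \in V then u else 0) + 1)); last first.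
  by move=> i _; case: ifP => _; rewrite ?add0r.
rewrite bigA_distr [RHS]big_mkcond/=.
rewrite [LHS](eq_bigl xpredT)//; apply: eq_bigr => Q _; rewrite powersetE.
have [/subsetP QV|/subsetPn[i iQ iV]] := boolP (Q \subset V); last first.
  by rewrite (bigD1 i)//= iQ (negbTE iV) mul0r.
rewrite -prodr_const [RHS]big_mkcond/=; apply: eq_bigr => i _.
by case: ifP => // /QV ->.
Qed.

(** The sets permuted by [f] are the unions of cycles of [f].  As cycles are
    disjoint and nonempty, such a set is the same thing as a set of cycles, and
    the sum becomes a binomial expansion. *)
Lemma sum_stable_sets (A : comNzRingType) (u : A) f :
  \sum_(S : {set T} | (f @: S == S)%SET) u ^+ #|(vertex_cycles f ::&: S)%SET|
    = (1 + u) ^+ #|vertex_cycles f|.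
Proof.
rewrite exp1D_powerset.
rewrite (reindex_onto (@cover T) (fun S => vertex_cycles f ::&: S)%SET);
  last first.
  by move=> S; exact: cover_vertex_cycles.
have K (Q : {set {set T}}) : Q \subset vertex_cycles f ->
  (vertex_cycles f ::&: cover Q)%SET = Q.
  move=> /subsetP QV; apply/setP => B; rewrite inE; apply/andP/idP; last first.
    by move=> BQ; rewrite QV//; split => //; exact: bigcup_sup.
  move=> [BV /subsetP BQ]; have [x xB] := vertex_cycle_neq0 BV.
  have /bigcupP[C CQ xC] := BQ _ xB.
  by rewrite (vertex_cycles_disjoint BV (QV _ CQ) xB xC).
apply: eq_big => [Q|Q /andP[_ /eqP ->]//].
rewrite powersetE; apply/andP/idP => [[_ /eqP <-]|QV].
  by apply/subsetP => B; rewrite inE => /andP[].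
rewrite K// eqxx; split => //; apply/eqP/setP => y.
apply/imsetP/bigcupP => [[x /bigcupP[B BQ xB] ->]|[B BQ]].
  exists B => //; rewrite -(vertex_cycle_stable (subsetP QV _ BQ)).
  exact: imset_f.
rewrite -{1}(vertex_cycle_stable (subsetP QV _ BQ)) => /imsetP[x xB ->].
by exists x => //; apply/bigcupP; exists B.
Qed.

End VertexCycles.

(** Each vertex has a single outgoing edge, so a directed cycle is determined by
    its vertices. *)
Lemma ncyclesE n (f : {ffun 'I_n -> 'I_n}) : ncycles f = #|vertex_cycles f|.
Proof.
pose gr (B : {set 'I_n}) := [set (x, f x) | x in B]%SET.
have gr_inj : injective gr.
  move=> B C BC; apply/setP => x.
  have grE (D : {set _}) : (x \in D) = ((x, f x) \in gr D).
    by apply/idP/imsetP => [xD|[y yD [->]]//]; exists x.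
  by rewrite !grE BC.
rewrite -(card_imset _ gr_inj); apply: eq_card => C; rewrite inE.
have Egr s : uniq s -> path.cycle (digraph_of f) s ->
    cycle_edges s = gr [set x in s]%SET.
  move=> us cs; rewrite /cycle_edges /gr.
  apply/setP => p; apply/imsetP/imsetP => -[x xs ->]; exists x => //.
  - by rewrite inE.
  - by rewrite (eqP (next_cycle cs xs)).
  - by move: xs; rewrite inE.
  - by rewrite inE in xs; rewrite (eqP (next_cycle cs xs)).
have cycE s : path.cycle (digraph_of f) s = fcycle f s.
  by apply: eq_cycle => x y /=; rewrite eq_sym.
apply/asboolP/imsetP.
  move=> [s [+ us cs ->]]; case: s us cs => // x s us cs _;
    exists (forward_orbit f x).
    apply/vertex_cyclesP; exists x => //; rewrite cycE in cs.
    by rewrite (fconnect_cycle cs) ?mem_head// mem_fcycle// mem_head.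
  rewrite Egr//; congr gr; apply/setP => y; rewrite !inE.
  by rewrite cycE in cs; rewrite (fconnect_cycle cs) ?mem_head.
move=> [B /vertex_cyclesP[x xx ->] ->]; exists (orbit f x).
have cx : fcycle f (orbit f x) by apply/(orbitPcycle 0 2).
split.
- by rewrite -size_eq0 size_orbit -lt0n fingraph.order_gt0.
- exact: orbit_uniq.
- by rewrite cycE.
- rewrite Egr ?orbit_uniq ?cycE//; congr gr; apply/setP => y.
  by rewrite !inE fconnect_orbit.
Qed.

(** * Parking functions that permute a set *)

(** List [A] and then its complement, do the same for [B], and match the two
    lists position by position. *)
Lemma exists_perm_imset (T : finType) (A B : {set T}) : #|A| = #|B| ->
  exists s : {perm T}, (s @: A = B)%SET.
Proof.
move=> AB.
pose e (C : {set T}) := enum C ++ enum (~: C)%SET.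
have size_e C : size (e C) = #|T| by rewrite size_cat -!cardE cardsC.
have mem_e C x : x \in e C by rewrite mem_cat !mem_enum inE orbN.
have uniq_e C : uniq (e C).
  rewrite cat_uniq !enum_uniq andbT/=; apply/hasPn => x.
  by rewrite !mem_enum inE.
pose g x := nth x (e B) (index x (e A)).
have g_inj : injective g.
  move=> x y; have lt z : (index z (e A) < size (e B))%N.
    by rewrite size_e -(size_e A) index_mem.
  rewrite /g (set_nth_default x y)// => /eqP; rewrite nth_uniq// => /eqP E.
  by rewrite -[x](nth_index x (mem_e A x)) E nth_index.
exists (perm g_inj); apply/eqP; rewrite eqEcard card_imset ?AB ?leqnn ?andbT;
  last exact: perm_inj.
apply/subsetP => _ /imsetP[x xA ->]; rewrite permE /g /e.
have ltx : (index x (e A) < size (enum B))%N.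
  by rewrite /e index_cat mem_enum xA -cardE -AB cardE index_mem mem_enum.
by rewrite nth_cat ltx -mem_enum mem_nth.
Qed.

Section ParkingCounts.
Variable n : nat.
Implicit Types (f : {ffun 'I_n -> 'I_n}) (S A : {set 'I_n}) (s : {perm 'I_n}).

(** The parking condition only involves the number of positions that take each
    value. *)
Lemma is_parking_perm f s : is_parking [ffun x => f (s x)] = is_parking f.
Proof.
apply: eq_forallb => i; congr (_ < _)%N.
rewrite -(card_imset _ (@perm_inj _ s)); apply: eq_card => y.
rewrite inE; apply/imsetP/idP => [[x]|fy].
  by rewrite inE ffunE => fx ->.
by exists (s^-1 y)%g; rewrite ?inE ?ffunE permKV.
Qed.

Definition precomp s f : {ffun 'I_n -> 'I_n} := [ffun x => f (s x)].

Lemma precompK s : cancel (precomp s) (precomp s^-1).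
Proof. by move=> f; apply/ffunP => x; rewrite !ffunE permKV. Qed.

Lemma precompVK s : cancel (precomp s^-1) (precomp s).
Proof. by move=> f; apply/ffunP => x; rewrite !ffunE permK. Qed.

Definition parking_fixing S :=
  #|[pred f | is_parking f & [forall x in S, f x == x]]|.

(** Precomposition with the inverse of [s] turns a function that agrees with [s]
    on [S] into one that fixes [S] pointwise, and preserves the parking
    condition. *)
Lemma card_parking_agree S s : perm_on S s ->
  #|[pred f | is_parking f & [forall x in S, f x == s x]]| = parking_fixing S.
Proof.
move=> sS; rewrite /parking_fixing -(card_imset _ (can_inj (precompVK s))).
apply: eq_card => g; rewrite inE;
  apply/imsetP/andP => [[f]|[gP /forall_inP gS]].
  rewrite inE => /andP[fP /forall_inP fS] ->; rewrite is_parking_perm;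
    split=> //.
  apply/forall_inP => x xS; rewrite ffunE (eqP (fS _ _)) ?permKV//.
  by rewrite perm_closed// perm_onV.
exists (precomp s g); last by rewrite precompK.
rewrite inE is_parking_perm gP; apply/forall_inP => x xS.
by rewrite ffunE gS// perm_closed.
Qed.

(** Sort the functions by the permutation of [S] that they induce: each
    permutation is induced equally often, so the sum over permutations factors
    out. *)
Lemma sum_parking_stable (R : comNzRingType) (u : R) S :
  \sum_(f : {ffun 'I_n -> 'I_n} | is_parking f && (f @: S == S)%SET)
     u ^+ #|(vertex_cycles f ::&: S)%SET|
  = rising u #|S| * (parking_fixing S)%:R.
Proof.
pose agree f s := [forall x in S, f x == s x].
have agreeP f s : reflect {in S, f =1 s} (agree f s).
  by apply: (iffP forall_inP) => H x xS; apply/eqP; exact: H.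
pose restr f := odflt 1%g [pick s | perm_on S s & agree f s].
have restrE f s : perm_on S s ->
    (f @: S == S)%SET && (restr f == s) = agree f s.
  move=> sS; apply/andP/agreeP => [[/stable_permP[t tS ft] /eqP <-]|fs].
    rewrite /restr; case: pickP => [t' /andP[_ /agreeP]//|/(_ t)].
    by rewrite tS (introT (agreeP f t) ft).
  split; first by apply/stable_permP; exists s.
  rewrite /restr; case: pickP => [t /andP[tS /agreeP ft]|/(_ s)] /=.
    by apply/eqP/(eq_perm_on tS sS) => x xS; rewrite -ft// fs.
  by rewrite sS (introT (agreeP f s) fs).
rewrite -sum_perm_cycles mulr_suml (partition_big restr (perm_on S));
  last first.
  move=> f _; rewrite /restr; case: pickP => [t /andP[]//|_].
  exact: perm_on1.
apply: eq_bigr => s sS; rewrite -(card_parking_agree sS) mulr_natr -sumr_const.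
apply: eq_big => f; first by rewrite -andbA restrE.
by rewrite -andbA restrE// => /andP[_ /agreeP fs];
  rewrite (vertex_cycles_within sS fs).
Qed.

Definition parking_inj_count A := #|[pred f | is_parking f & #|f @: A|
  == #|A|]|.

Lemma rising1 (R : comNzRingType) k : rising (1 : R) k = k`!%:R.
Proof.
rewrite /rising; elim: k => [|k IH]; first by rewrite big_ord0.
by rewrite big_ord_recr/= IH factS mulnC natrM -[k.+1]add1n natrD.
Qed.

(** A function that is injective on [A] maps [A] onto some [S] of the same
    cardinality; permuting the positions, one may assume that [A] is [S], and
    then the function permutes [S]. *)
Lemma parking_inj_countE A :
  parking_inj_count A = (#|A|`! * \sum_(S : {set _} | #|S| == #|A|)
    parking_fixing S)%N.
Proof.
(* The case [u = 1] of the previous sum counts functions. *)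
have st (S : {set _}) : #|[pred f | is_parking f & (f @: S == S)%SET]| =
    (#|S|`! * parking_fixing S)%N.
  apply/eqP; rewrite -(eqr_nat rat) natrM -rising1 -sum_parking_stable.
  by rewrite -sumr_const; apply/eqP/eq_bigr => f _; rewrite expr1n.
rewrite big_distrr/= /parking_inj_count -[LHS]sum1_card.
rewrite (partition_big (fun f : {ffun 'I_n -> 'I_n} => f @: A)%SET
  (fun S : {set 'I_n} => #|S| == #|A|)); last first.
  by move=> f; rewrite inE => /andP[].
apply: eq_bigr => S /eqP SA; rewrite -SA -st sum1dep_card.
have [t tS] := exists_perm_imset SA.
rewrite -(card_imset _ (can_inj (precompK t))); apply: eq_card => g.
rewrite inE; apply/imsetP/andP => [[f]|[gP /eqP gS]].
  rewrite !inE => /andP[/andP[fP _] /eqP fA] ->; rewrite is_parking_perm;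
    split=> //.
  rewrite -{2}fA -tS -imset_comp; apply/eqP/eq_imset => x.
  by rewrite ffunE.
exists (precomp t^-1 g); last by rewrite precompVK.
have E : (precomp t^-1 g @: A = S)%SET.
  rewrite -tS -imset_comp -[RHS]gS; apply: eq_imset => x.
  by rewrite /= ffunE permK.
by rewrite !inE is_parking_perm gP E SA !eqxx.
Qed.

Definition initial_positions k := [set i : 'I_n | (i < k)%N]%SET.

Lemma card_initial_positions k : (k <= n)%N -> #|initial_positions k| = k.
Proof.
move=> kn; have w_inj : injective (widen_ord kn).
  by move=> i j /(congr1 val)/= ij; exact: val_inj.
rewrite -[RHS]card_ord -(card_imset _ w_inj).
apply: eq_card => i; rewrite inE; apply/idP/imsetP => [ik|[j _ ->]];
  last exact: (ltn_ord j).
by exists (Ordinal ik) => //; apply: val_inj.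
Qed.

(** With [u = 'X - 1] the base [1 + u] of the expansion over stable sets becomes
    ['X], and grouping those sets by cardinality leaves the counts of the
    functions injective on [k] positions. *)
Lemma sum_parking_ncycles (F : numFieldType) :
  \sum_(f : {ffun 'I_n -> 'I_n} | is_parking f) 'X^(ncycles f) =
  \sum_(k < n.+1) ((parking_inj_count (initial_positions k))%:R / k`!%:R)
    *: rising ('X - 1) k
  :> {poly F}.
Proof.
rewrite (eq_bigr (fun f : {ffun 'I_n -> 'I_n} =>
  \sum_(S : {set 'I_n} | (f @: S == S)%SET)
    ('X - 1) ^+ #|(vertex_cycles f ::&: S)%SET|)); last first.
  by move=> f _; rewrite sum_stable_sets ncyclesE addrC subrK.
rewrite (exchange_big_dep xpredT)//=.
under eq_bigr do rewrite sum_parking_stable.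
rewrite (partition_big (fun S : {set 'I_n} => inord #|S| : 'I_n.+1) xpredT)//=.
apply: eq_bigr => k _.
rewrite (eq_bigl (fun S : {set 'I_n} => #|S| == k)); last first.
  by move=> S; rewrite -val_eqE/= inordK// ltnS -[X in (_ <= X)%N](card_ord n)
    max_card.
rewrite parking_inj_countE card_initial_positions ?(leq_ord k)// natrM mulrAC
  divff ?pnatr_eq0 -?lt0n ?fact_gt0//.
rewrite mul1r (eq_bigr (fun S => rising ('X - 1) k * (parking_fixing S)%:R));
  last by move=> S /eqP ->.
by rewrite -mulr_sumr -natr_sum mulr_natr scaler_nat.
Qed.

End ParkingCounts.

(** * The circular argument *)

Section Pollak.
Variable n : nat.
Implicit Types (g : {ffun 'I_n -> 'I_n.+1}) (A : {set 'I_n}) (r : 'I_n.+1).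

(** The parking condition for [n] cars on a circle with [n.+1] places.  The
    condition at the last [i] forces all the values to be below [n]. *)
Definition circular_parking g :=
  [forall i : 'I_n, (i < #|[set k | (g k <= i)%N]%SET|)%N].

Definition rotate r g : {ffun 'I_n -> 'I_n.+1} := [ffun k => g k - r].

Lemma val_ordB (x r : 'I_n.+1) :
  val (x - r) = if (r <= x)%N then (x - r)%N else (x + n.+1 - r)%N.
Proof.
have xn := ltn_ord x; have rn := ltn_ord r.
rewrite /= modnDmr; case: leqP => rx.
  rewrite (_ : (x + (n.+1 - r))%N = (x - r + n.+1)%N); last by lia.
  by rewrite modnDr modn_small//; lia.
by rewrite modn_small; lia.
Qed.

(** This is the cycle lemma.  With [G m] the number of values below [m], the
    rotation by [r] satisfies the condition exactly when [r] is the first point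
    of [0, n] where [G m - m] reaches its minimum, and there is exactly one such
    point. *)
Lemma unique_rotation g : exists r0, forall r,
  circular_parking (rotate r g) = (r == r0).
Proof.
pose G m := #|[set k | (g k < m)%N]%SET|.
have Gn : G n.+1 = n.
  rewrite /G -[RHS]card_ord -cardsT; apply: eq_card => k.
  by rewrite !inE ltn_ord.
have G0 : G 0 = 0%N by apply: eq_card0 => k; rewrite inE.
have GD i j : (i <= j)%N -> (#|[set k | (i <= g k < j)%N]%SET| + G i = G j)%N.
  move=> ij; rewrite /G -cardsUI (_ : _ :&: _ = set0)%SET ?cards0 ?addn0.
    by apply: eq_card => k; rewrite !inE; lia.
  by apply/setP => k; rewrite !inE; lia.
(* Values in the arc of length [i.+1] that starts at [r]: [cnt1] when the arc
   stops before place 0, [cnt2] when it wraps around. *)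
have cnt1 r (i : nat) : (r + i <= n)%N ->
    (#|[set k | (rotate r g k <= i)%N]%SET| + G r = G (r + i).+1)%N.
  move=> rin; rewrite -(@GD r (r + i).+1); last lia.
  congr (_ + _)%N; apply: eq_card => k; rewrite !inE ffunE val_ordB.
  have := ltn_ord (g k); case: (leqP r (g k)) => h1 h2; apply/idP/idP; lia.
have cnt2 r (i : nat) : (n < r + i)%N -> (i < n)%N ->
    (#|[set k | (rotate r g k <= i)%N]%SET| + G r = n + G (r + i - n))%N.
  move=> rin ii; rewrite -[X in _ = (X + _)%N]Gn -(@GD r n.+1);
    last by have := ltn_ord r; lia.
  rewrite addnAC; congr (_ + _)%N.
  rewrite /G -cardsUI [X in (_ = _ + X)%N](_ : _ = 0%N) ?addn0.
    apply: eq_card => k; rewrite !inE ffunE val_ordB.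
    have := ltn_ord (g k); have := ltn_ord r.
    by case: (leqP r (g k)) => h1 h2 h3; apply/idP/idP; lia.
  apply: eq_card0 => k; rewrite !inE; have := ltn_ord r; lia.
have goodP r : reflect
    ((forall j, r < j <= n -> G r + j <= G j + r)%N /\
     (forall j, j < r -> G r + j < G j + r)%N)
    (circular_parking (rotate r g)).
  have rn := ltn_ord r.
  apply: (iffP forallP) => [H|[H1 H2] i].
    have K1 j : (r < j <= n.+1)%N -> (j <= r + n)%N -> (G r + j <= G j + r)%N.
      move=> rj jn; have ii : (j - r.+1 < n)%N by lia.
      have /= := H (Ordinal ii); rewrite -(ltn_add2r (G r)) cnt1; last lia.
      rewrite (_ : (r + (j - r.+1)).+1 = j); last lia.
      lia.
    split=> [j rj|j jr]; first by apply: K1; lia.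
    have [->|j0] := eqVneq j 0%N.
      have := K1 n.+1; rewrite G0 Gn; lia.
    have ii : (j + n - r < n)%N by lia.
    have /= := H (Ordinal ii); rewrite -(ltn_add2r (G r)) cnt2; [|lia|lia].
    rewrite (_ : (r + (j + n - r) - n)%N = j); last lia.
    lia.
  have ii := ltn_ord i.
  have [rin|rin] := leqP (r + i) n.
    rewrite -(ltn_add2r (G r)) cnt1//.
    have [E|ne] := eqVneq (r + i)%N n.
      have := H2 0%N; rewrite E Gn G0; lia.
    by have := H1 (r + i).+1; lia.
  by rewrite -(ltn_add2r (G r)) cnt2//; have := H2 (r + i - n)%N; lia.
(* Minimizing [t] means minimizing [G j - j] and, among ties, [j]. *)
pose t (j : 'I_n.+1) := ((G j + (n - j)) * n.+1 + j)%N.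
have [r0 _ r0min] := arg_minnP t (erefl (xpredT (ord0 : 'I_n.+1))).
exists r0 => r; apply/goodP/eqP => [[H1 H2]|->].
  apply: val_inj => /=; apply/eqP; case: ltngtP => // rr0.
    have := r0min r isT; rewrite /t.
    have := H1 r0; have := ltn_ord r0; have := ltn_ord r; nia.
  have := r0min r isT; rewrite /t.
  have := H2 r0; have := ltn_ord r0; have := ltn_ord r; nia.
split=> [j jn|j jr].
  have jj : (j < n.+1)%N by lia.
  have := r0min (Ordinal jj) isT; rewrite /t/=.
  have := ltn_ord r0; nia.
have jj : (j < n.+1)%N by have := ltn_ord r0; lia.
have := r0min (Ordinal jj) isT; rewrite /t/=.
have := ltn_ord r0; nia.
Qed.

Definition map_inj_count (A : {set 'I_n}) :=
  #|[set g : {ffun 'I_n -> 'I_n.+1} | #|g @: A|%SET == #|A|]%SET|.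

Lemma rotateK r : cancel (rotate r) (rotate (- r)).
Proof. by move=> g; apply/ffunP => k; rewrite !ffunE opprK subrK. Qed.

Lemma rotateVK r : cancel (rotate (- r)) (rotate r).
Proof. by move=> g; apply/ffunP => k; rewrite !ffunE opprK addrK. Qed.

Lemma card_rotate_imset r g A : #|(rotate r g @: A)%SET| = #|(g @: A)%SET|.
Proof.
rewrite (_ : (rotate r g @: A = (fun x => x - r) @: (g @: A))%SET).
  by rewrite card_imset//; exact: addIr.
by rewrite -imset_comp; apply: eq_imset => k; rewrite /= ffunE.
Qed.

Lemma card_circular_parking A :
  #|[set g | circular_parking g & #|g @: A|%SET == #|A|]%SET|
    = parking_inj_count A.
Proof.
pose w (f : {ffun 'I_n -> 'I_n}) : {ffun 'I_n -> 'I_n.+1} :=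
  [ffun k => widen_ord (leqnSn n) (f k)].
have wi_inj : injective (widen_ord (leqnSn n)).
  by move=> i j /(congr1 val)/= ij; exact: val_inj.
have w_inj : injective w.
  move=> f g /ffunP fg; apply/ffunP => k; apply: wi_inj.
  by have := fg k; rewrite !ffunE.
have cw f : circular_parking (w f) = is_parking f.
  apply: eq_forallb => i; congr (_ < _)%N; apply: eq_card => k.
  by rewrite !inE ffunE.
have iw f : #|(w f @: A)%SET| = #|(f @: A)%SET|.
  rewrite -[RHS](card_imset _ wi_inj) -imset_comp.
  by apply: eq_card => x; congr (x \in pred_of_set _); apply: eq_imset => k;
    rewrite /= ffunE.
rewrite /parking_inj_count -(card_imset _ w_inj); apply: eq_card => g.
rewrite inE; apply/andP/imsetP => [[gP gA]|[f]]; last first.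
  by rewrite inE => /andP[fP fA] ->; rewrite cw iw.
have gn k : (g k < n)%N.
  have nn : (n.-1 < n)%N by have := ltn_ord k; lia.
  have := forallP gP (Ordinal nn) => /=; rewrite prednK; last lia.
  move=> full; have : k \in [set k | (g k <= n.-1)%N]%SET.
    rewrite (_ : [set k | _] = setT)%SET ?inE//; apply/eqP.
    by rewrite eqEcard subsetT cardsT card_ord.
  by rewrite inE -ltnS prednK//; exact: leq_ltn_trans (leq0n _) nn.
have wg : g = w [ffun k => Ordinal (gn k)].
  by apply/ffunP => k; apply: val_inj; rewrite !ffunE.
exists [ffun k => Ordinal (gn k)] => //.
by rewrite inE -cw -iw -wg gP.
Qed.

(** Every map has exactly one rotation that satisfies the parking condition, and
    rotations do not change injectivity on [A]. *)
Lemma pollak A : (n.+1 * parking_inj_count A)%N = map_inj_count A.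
Proof.
rewrite /map_inj_count -sum1_card.
transitivity (\sum_(g in [set g : {ffun 'I_n -> 'I_n.+1} | #|g @: A|%SET
  == #|A|]%SET)
  \sum_(r : 'I_n.+1 | circular_parking (rotate r g)) 1)%N; last first.
  apply: eq_bigr => g _; have [r0 r0P] := unique_rotation g.
  by rewrite (eq_bigl _ _ r0P) big_pred1_eq.
rewrite (exchange_big_dep xpredT)//= -[X in (X * _)%N]card_ord -sum_nat_const.
apply: eq_bigr => r _; rewrite sum1dep_card -card_circular_parking.
rewrite -(card_imset _ (can_inj (rotateVK r))); apply: eq_card => g.
rewrite inE; apply/imsetP/andP => [[h]|[gA gP]].
  by rewrite inE => /andP[hP hA] ->; rewrite inE card_rotate_imset rotateVK.
exists (rotate r g); last by rewrite rotateK.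
by move: gA; rewrite !inE card_rotate_imset gP => ->.
Qed.

(** Count the pairs of a map injective on [A] and a value that it does not take
    on [A].  Exchanging the spare value with the value at [x] is an involution
    that identifies them with the pairs of a map injective on [x |: A] and an
    arbitrary value. *)
Lemma map_inj_countU1 A x : x \notin A ->
  (n.+1 * map_inj_count (x |: A)%SET = (n.+1 - #|A|) * map_inj_count A)%N.
Proof.
move=> xA.
pose upd (p : {ffun 'I_n -> 'I_n.+1} * 'I_n.+1) :
    {ffun 'I_n -> 'I_n.+1} * 'I_n.+1 :=
  ([ffun k => if k == x then p.2 else p.1 k], p.1 x).
have updK : involutive upd.
  move=> [g v]; rewrite /upd/= !ffunE eqxx; congr pair; apply/ffunP => k.
  by rewrite !ffunE; case: eqP => // ->.
transitivity #|[set p : {ffun 'I_n -> 'I_n.+1} * 'I_n.+1 |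
    (#|p.1 @: (x |: A)| == #|x |: A|)%SET ]%SET|.
  rewrite mulnC /map_inj_count -[X in (_ * X)%N](card_ord n.+1) -cardsT -cardsX.
  by apply: eq_card => p; rewrite !inE andbT.
rewrite -(card_imset _ (inv_inj updK)).
transitivity #|[set p : {ffun 'I_n -> 'I_n.+1} * 'I_n.+1 |
    (#|p.1 @: A| == #|A|)%SET && (p.2 \notin p.1 @: A)%SET]%SET|.
  apply: eq_card => q; rewrite -{1}(updK q) (mem_imset _ _ (inv_inj updK)) !inE.
  rewrite imsetU1 !cardsU1 xA /= ffunE eqxx.
  rewrite (_ : [set (upd q).1 k | k in A]%SET = (q.1 @: A)%SET); last first.
    apply: eq_in_imset => k kA; rewrite ffunE; case: eqP => // kx.
    by rewrite -kx kA in xA.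
  have := leq_imset_card q.1 A; set b := (_ \notin _).
  case: b => /= h; first by rewrite eqn_add2l andbT.
  rewrite andbF; apply/negbTE/eqP => E; move: h.
  by rewrite -[X in (X <= _)%N]add0n E add1n ltnn.
rewrite -sum1_card (eq_bigl (fun p : {ffun 'I_n -> 'I_n.+1} * 'I_n.+1 =>
  (#|p.1 @: A| == #|A|)%SET && (p.2 \notin p.1 @: A)%SET)); last first.
  by move=> p; rewrite inE.
rewrite -(pair_big_dep (fun g : {ffun 'I_n -> 'I_n.+1} => #|g @: A| == #|A|)%SET
  (fun (g : {ffun 'I_n -> 'I_n.+1}) v => v \notin (g @: A)%SET)
    (fun _ _ => 1%N)) /=.
rewrite mulnC /map_inj_count -sum1dep_card big_distrl/=;
  apply: eq_bigr => g /eqP gA.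
rewrite sum1dep_card mul1n -gA cardsCs card_ord; congr (_ - _)%N.
by apply: eq_card => v; rewrite !inE negbK.
Qed.

End Pollak.

(** * The number of cycles as a mixture *)

Section Abel.
Variables (R : pzRingType) (V : lmodType R).

Lemma abel_sum (a : nat -> R) (g : nat -> V) n :
  \sum_(c < n.+1) (a c - (if (c < n)%N then a c.+1 else 0)) *: g c =
  a 0%N *: g 0%N + \sum_(k < n) a k.+1 *: (g k.+1 - g k).
Proof.
rewrite big_ord_recr/= ltnn subr0
  (eq_bigr (fun c : 'I_n => (a c - a c.+1) *: g c));
  last by move=> c _; rewrite ltn_ord.
elim: n => [|n IH]; first by rewrite !big_ord0 add0r addr0.
rewrite !big_ord_recr/= addrA -IH scalerBl scalerBr.
by rewrite -!addrA; congr (_ + (_ + _)); rewrite addrC.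
Qed.
End Abel.

Section Mixture.
Variable F : numFieldType.

(** The proportion of parking functions that are injective on [k] given
    positions, when [k <= n]; see [parking_inj_count_survival]. *)
Definition survival n k : F := \prod_(i < k) (1 - i%:R / n.+1%:R).

(** The law of the mixing variable, whose tail probabilities are
    [survival n k] up to [k = n] and vanish beyond. *)
Definition core_weight n c : F :=
  survival n c - (if (c < n)%N then survival n c.+1 else 0).

Lemma survivalS n k : survival n k.+1 = survival n k * (1 - k%:R / n.+1%:R).
Proof. by rewrite /survival big_ord_recr. Qed.

Lemma parking_inj_count_survival n k : (k <= n)%N ->
  (parking_inj_count (initial_positions n k))%:R =
  survival n k * (parking_inj_count (set0 : {set 'I_n}))%:R :> F.
Proof.
have N0 : n.+1%:R != 0 :> F by rewrite pnatr_eq0.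
elim: k => [_|k IH kn].
  rewrite /survival big_ord0 mul1r.
  by rewrite (_ : initial_positions n 0 = set0)//; apply/setP => i;
    rewrite !inE.
pose x := Ordinal kn.
have E : initial_positions n k.+1 = (x |: initial_positions n k)%SET.
  by apply/setP => i; rewrite !inE -val_eqE/= ltnS leq_eqVlt.
have xk : x \notin initial_positions n k by rewrite inE/= ltnn.
have := map_inj_countU1 xk; rewrite -!pollak -E card_initial_positions;
  last exact: ltnW.
rewrite mulnA [RHS]mulnCA -mulnA => /eqP; rewrite eqn_mul2l/= => /eqP rec.
apply: (mulfI N0); rewrite -natrM rec natrM IH ?(ltnW kn)// survivalS.
rewrite natrB; last by rewrite leqW// ltnW.
by field; rewrite addrC natr1.
Qed.

Definition rising_binomial (k : nat) : {poly F} := k`!%:R^-1 *: rising 'X k.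

(** Divided by [k.+1`!], this is Pascal's rule for the binomial coefficients of
    multisets. *)
Lemma rising_shift (A : comNzRingType) (u : A) k :
  rising (u + 1) k.+1 - k.+1%:R * rising (u + 1) k = rising u k.+1.
Proof.
have E : rising u k.+1 = u * rising (u + 1) k.
  rewrite /rising big_ord_recl/= addr0; congr (_ * _).
  by apply: eq_bigr => i _; rewrite /bump/= add1n -addrA -natr1 [1 + _]addrC.
rewrite E {1}/rising big_ord_recr/= -/(rising (u + 1) k).
by rewrite -natr1; ring.
Qed.

Lemma core_weight_sum (n : nat) (V : lmodType F) (g : nat -> V) :
  \sum_(c < n.+1) core_weight n c *: g c =
  g 0%N + \sum_(k < n) survival n k.+1 *: (g k.+1 - g k).
Proof. by rewrite abel_sum /survival big_ord0 scale1r. Qed.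

(** By [rising_shift], passing from ['X - 1] to ['X] amounts to taking
    differences of the [rising_binomial]s, which summation by parts moves to the
    weights. *)
Lemma sum_parking_mixture n :
  \sum_(f : {ffun 'I_n -> 'I_n} | is_parking f) 'X^(ncycles f) =
  (parking_inj_count (set0 : {set 'I_n}))%:R *:
    \sum_(c < n.+1) core_weight n c *: rising_binomial c.
Proof.
rewrite sum_parking_ncycles core_weight_sum big_ord_recl scalerDr;
  congr (_ + _).
  rewrite parking_inj_count_survival// /survival big_ord0 mul1r fact0 divr1.
  by rewrite /rising_binomial fact0 invr1 scale1r /rising !big_ord0.
rewrite scaler_sumr; apply: eq_bigr => k _.
rewrite lift0 parking_inj_count_survival// [survival _ _ * _]mulrC -mulrA
  -!scalerA.
congr (_ *: (_ *: _)).
rewrite -rising_shift subrK scalerBr /rising_binomial; congr (_ - _).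
rewrite mulr_natl -scaler_nat scalerA; congr (_ *: _).
rewrite factS natrM invfM mulrAC mulVf ?mul1r// pnatr_eq0//.
Qed.

(** The mean of [g] at the number of cycles of a uniform permutation of [c]
    points: the last point inserted opens a new cycle with probability
    [c^-1]. *)
Fixpoint ecycles (c : nat) (g : nat -> F) : F :=
  if c is c'.+1 then
    (c'%:R * ecycles c' g + ecycles c' (g \o succn)) / c'.+1%:R
  else g 0%N.

(** The linear functional that sends ['X^k] to [g k], truncated to the first [N]
    coefficients; it turns a generating polynomial into a mean. *)
Definition coef_pairing N (g : nat -> F) (p : {poly F}) :=
  \sum_(i < N) p`_i * g i.

Lemma coef_pairing_sum N g (I : Type) (r : seq I) (P : pred I)
  (p : I -> {poly F}) :
  coef_pairing N g (\sum_(i <- r | P i) p i) =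
  \sum_(i <- r | P i) coef_pairing N g (p i).
Proof.
rewrite /coef_pairing exchange_big/=; apply: eq_bigr => i _.
by rewrite coef_sum mulr_suml.
Qed.

Lemma coef_pairingZ N g a p :
  coef_pairing N g (a *: p) = a * coef_pairing N g p.
Proof.
by rewrite /coef_pairing mulr_sumr; apply: eq_bigr => i _; rewrite coefZ mulrA.
Qed.

Lemma coef_pairingXn N g k : (k < N)%N -> coef_pairing N g 'X^k = g k.
Proof.
move=> kN; rewrite /coef_pairing (bigD1 (Ordinal kN))//= coefXn eqxx mul1r.
rewrite big1 ?addr0// => i; rewrite -val_eqE/= => /negbTE ik.
by rewrite coefXn ik mul0r.
Qed.

Lemma coef_pairing_rising_binomial N g c : (c < N)%N ->
  coef_pairing N g (rising_binomial c) = ecycles c g.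
Proof.
elim: c N g => [|c IH] N g cN.
  rewrite /rising_binomial /rising big_ord0 fact0 invr1 scale1r -(expr0 'X).
  by rewrite coef_pairingXn.
case: N cN => // N; rewrite ltnS => cN.
have -> : rising_binomial c.+1 =
    c.+1%:R^-1 *: (c%:R *: rising_binomial c + 'X * rising_binomial c).
  rewrite /rising_binomial /rising big_ord_recr/= factS natrM invfM -scalerA.
  congr (_ *: _); rewrite -scalerAr scalerA [X in X *: _ + _]mulrC -scalerA
    -scalerDr.
  by congr (_ *: _); rewrite mulrDr addrC mulr_natr scaler_nat ['X * _]mulrC.
rewrite coef_pairingZ mulrC /=; congr (_ / _).
have -> : coef_pairing N.+1 g (c%:R *: rising_binomial c + 'X * rising_binomial
  c)
    = coef_pairing N.+1 g (c%:R *: rising_binomial c)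
      + coef_pairing N.+1 g ('X * rising_binomial c).
  by rewrite /coef_pairing -big_split; apply: eq_bigr => i _;
    rewrite coefD mulrDl.
rewrite coef_pairingZ IH ?(ltnW cN)//; last exact: leqW.
congr (_ + _); rewrite -(IH N)//.
rewrite {1}/coef_pairing big_ord_recl coefXM/= mul0r add0r.
by apply: eq_bigr => i _; rewrite coefXM.
Qed.

(** The uniform parking function has as many cycles, in law, as a uniform
    permutation of a random number of points distributed as
    [core_weight n]. *)
Lemma sum_parking_ecycles n (g : nat -> F) :
  \sum_(f : {ffun 'I_n -> 'I_n} | is_parking f) g (ncycles f) =
  (parking_inj_count (set0 : {set 'I_n}))%:R *
    \sum_(c < n.+1) core_weight n c * ecycles c g.
Proof.
pose M := (n.+1 + \max_(f : {ffun 'I_n -> 'I_n}) ncycles f).+1.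
have := congr1 (coef_pairing M g) (sum_parking_mixture n).
rewrite coef_pairing_sum coef_pairingZ coef_pairing_sum.
under eq_bigr => f _.
  rewrite coef_pairingXn; last first.
    by rewrite ltnS (leq_trans _ (leq_addl _ _))// leq_bigmax.
  over.
move=> ->; congr (_ * _); apply: eq_bigr => c _.
rewrite coef_pairingZ coef_pairing_rising_binomial//.
by rewrite (leq_trans (ltn_ord c))// /M -addSn; exact: leq_trans (leqnSn _)
  (leq_addr _ _).
Qed.

End Mixture.

From mathcomp Require Import all_classical all_reals all_analysis.
From mathcomp Require Import measurable_realfun.

Import numFieldNormedType.Exports.

(** * Size of the mixing variable *)

Section CoreSize.
Variables (R : realType) (n : nat).
Hypothesis n_gt0 : (0 < n)%N.
Local Notation N := (n.+1%:R : R).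
Local Notation surv := (survival R n).
Local Notation wt := (core_weight R n).
Let s : R := Num.sqrt N.

Let N_gt0 : 0 < N. Proof. by rewrite ltr0n. Qed.
Let s_gt0 : 0 < s. Proof. by rewrite sqrtr_gt0. Qed.
Let s2 : s ^+ 2 = N. Proof. by rewrite sqr_sqrtr// ltW. Qed.

Lemma survival_ge0 k : (k <= n.+1)%N -> 0 <= surv k.
Proof.
move=> kn; apply: prodr_ge0 => i _.
by rewrite subr_ge0 ler_pdivrMr// mul1r ler_nat ltnW// (leq_trans (ltn_ord i)).
Qed.

(** Except at the end point, the weight at [c] is the survival probability
    times [c / n.+1].  The two bounds below follow; they convert sums of weights
    into sums of survival probabilities and back. *)
Lemma core_weightE c : (c < n)%N -> wt c = surv c * (c%:R / N).
Proof. by move=> cn; rewrite /core_weight cn survivalS; ring. Qed.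

Lemma core_weight_max : wt n = surv n.
Proof. by rewrite /core_weight ltnn subr0. Qed.

Lemma core_weight_ge c : (c <= n)%N -> surv c * (c%:R / N) <= wt c.
Proof.
rewrite leq_eqVlt => /orP[/eqP ->|/core_weightE ->//].
rewrite core_weight_max ler_piMr ?survival_ge0//.
by rewrite ler_pdivrMr// mul1r ler_nat.
Qed.

Lemma core_weight_le c : (c <= n)%N -> wt c <= 2 * (surv c * (c%:R / N)).
Proof.
move=> cn; have P : 0 <= surv c * (c%:R / N).
  by rewrite mulr_ge0 ?divr_ge0 ?survival_ge0// leqW.
move: cn P; rewrite leq_eqVlt => /orP[/eqP ->|/core_weightE -> P];
  last by rewrite ler_peMl// ler1n.
move=> _; rewrite core_weight_max mulrCA ler_peMr ?survival_ge0//.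
by rewrite mulrA ler_pdivlMr// mul1r -natrM ler_nat; lia.
Qed.

Lemma core_weight_ge0 c : (c <= n)%N -> 0 <= wt c.
Proof.
move=> cn; apply: le_trans (core_weight_ge cn).
by rewrite mulr_ge0 ?divr_ge0 ?survival_ge0// leqW.
Qed.

Lemma core_weight0 : wt 0 = 0.
Proof. by rewrite core_weightE// mul0r mulr0. Qed.

Lemma core_weight_sumR (g : nat -> R) :
  \sum_(c < n.+1) wt c * g c = g 0%N + \sum_(k < n) surv k.+1 * (g k.+1 - g k).
Proof. exact: (@core_weight_sum R n R^o). Qed.

Lemma sum_core_weight : \sum_(c < n.+1) wt c = 1.
Proof.
have := core_weight_sumR (fun=> 1); under eq_bigr do rewrite mulr1.
by move=> ->; rewrite big1 ?addr0// => k _; rewrite subrr mulr0.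
Qed.

Lemma core_mean : \sum_(c < n.+1) wt c * c%:R = \sum_(k < n) surv k.+1.
Proof.
rewrite (core_weight_sumR (fun c => c%:R)) add0r; apply: eq_bigr => k _.
by rewrite -natrB// subSnn mulr1.
Qed.

(** By parts the second moment is the sum of [survival n k.+1 * (2 k + 1)],
    and [survival n k * k] is at most [n.+1] times the weight at [k], whose sum
    is [1]. *)
Lemma core_second_moment : \sum_(c < n.+1) wt c * c%:R ^+ 2 <= 2 * N.
Proof.
rewrite (core_weight_sumR (fun c => c%:R ^+ 2)) expr0n add0r.
have -> : 2 * N = 2 * N * \sum_(c < n.+1) wt c by rewrite sum_core_weight mulr1.
rewrite big_ord_recl core_weight0 add0r mulr_sumr; apply: ler_sum => k _.
rewrite lift0.
apply: le_trans (_ : 2 * N * (surv k.+1 * (k.+1%:R / N)) <= _); last first.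
  by rewrite ler_pM2l ?core_weight_ge// mulr_gt0.
have -> : 2 * N * (surv k.+1 * (k.+1%:R / N)) = surv k.+1 * (2 * k.+1%:R).
  by field; rewrite gt_eqF.
rewrite ler_wpM2l ?survival_ge0// ?ltnS ?(ltnW (ltn_ord k))//.
by rewrite -(natr1 k); lra.
Qed.

(** Between the first two moments, by [c <= s / 2 + c ^+ 2 / (2 s)] with
    [s ^+ 2 = n.+1]. *)
Lemma core_mean_le : \sum_(c < n.+1) wt c * c%:R <= 3 / 2 * s.
Proof.
apply: le_trans (_ : \sum_(c < n.+1) wt c * (s / 2 + c%:R ^+ 2 / (2 * s)) <= _).
  apply: ler_sum => c _; rewrite ler_wpM2l ?core_weight_ge0 ?leq_ord//.
  rewrite -subr_ge0.
  have -> : s / 2 + c%:R ^+ 2 / (2 * s) - c%:R = (s - c%:R) ^+ 2 / (2 * s).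
    by field; rewrite gt_eqF.
  by rewrite divr_ge0 ?sqr_ge0// mulr_ge0// ltW.
under eq_bigr do rewrite mulrDr mulrA.
rewrite big_split/= -!mulr_suml sum_core_weight mul1r.
under eq_bigr do rewrite mulrA.
rewrite -mulr_suml.
have : (\sum_(c < n.+1) wt c * c%:R ^+ 2) / (2 * s) <= s.
  rewrite ler_pdivrMr ?mulr_gt0//.
  have -> : s * (2 * s) = 2 * s ^+ 2 by ring.
  by rewrite s2; exact: core_second_moment.
lra.
Qed.

(** The factor [c] in the weight at [c] cancels the inverse, which leaves the
    sum of survival probabilities, that is the mean. *)
Lemma core_inverse_mean_le : \sum_(c < n.+1) wt c * (s / c%:R) <= 3.
Proof.
rewrite big_ord_recl core_weight0 mul0r add0r.
apply: le_trans (_ : 2 / s * \sum_(k < n) surv k.+1 <= _).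
  rewrite mulr_sumr; apply: ler_sum => k _; rewrite lift0.
  apply: le_trans (_ : 2 * (surv k.+1 * (k.+1%:R / N)) * (s / k.+1%:R) <= _).
    by rewrite ler_wpM2r ?core_weight_le// divr_ge0// ltW.
  rewrite -s2 le_eqVlt; apply/orP; left; apply/eqP; field.
  by rewrite gt_eqF//= -natr1 addrC natr1 pnatr_eq0.
rewrite -core_mean.
apply: le_trans (_ : 2 / s * (3 / 2 * s) <= _).
  by rewrite ler_wpM2l ?core_mean_le// divr_ge0// ltW.
by rewrite le_eqVlt; apply/orP; left; apply/eqP; field; rewrite gt_eqF.
Qed.

End CoreSize.

Section Harmonic.
Variable R : realType.
Definition harmonic_number c : R := \sum_(i < c) i.+1%:R^-1.

Lemma ln_sub1 (x : R) : 0 < x -> ln x <= x - 1.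
Proof.
move=> x0; have := @le_ln1Dx R (x - 1); rewrite addrCA subrr addr0; apply.
lra.
Qed.

Lemma harmonic_number_ln c : (0 < c)%N -> ln c%:R <= harmonic_number c <=
  1 + ln c%:R.
Proof.
move=> c0; apply/andP; split.
  apply: le_trans (_ : ln (c.+1%:R : R) <= _).
    by rewrite ler_ln ?posrE ?ltr0n// ler_nat.
  elim: c {c0} => [|c IH]; first by rewrite ln1 /harmonic_number big_ord0.
  rewrite /harmonic_number big_ord_recr/= -/(harmonic_number c);
    apply: le_trans (lerD IH (lexx _)).
  rewrite -lerBlDl -ln_div ?posrE ?ltr0n//; apply: le_trans (ln_sub1 _) _.
    by rewrite divr_gt0.
  rewrite le_eqVlt; apply/orP; left; apply/eqP.
  rewrite -(natr1 c.+1); have : c.+1%:R != 0 :> R by rewrite pnatr_eq0.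
  by move: (c.+1%:R : R) => x x0; field.
elim: c c0 => // -[_ _|c /(_ isT) IH _].
  by rewrite /harmonic_number big_ord1 ln1 addr0 invr1.
rewrite /harmonic_number big_ord_recr/= -/(harmonic_number c.+1).
apply: le_trans (lerD IH (lexx _)) _; rewrite -addrA lerD2l.
rewrite addrC -lerBrDr -[leLHS]opprK lerNl opprB -ln_div ?posrE ?ltr0n//.
apply: le_trans (ln_sub1 _) _; first by rewrite divr_gt0.
rewrite le_eqVlt; apply/orP; left; apply/eqP.
have : c.+2%:R != 0 :> R by rewrite pnatr_eq0.
by rewrite -(natr1 c.+1); move: (c.+1%:R : R) => x x0; field.
Qed.

Lemma normr_ln_le (x : R) : 0 < x -> `|ln x| <= x + x^-1.
Proof.
move=> x0; have y0 : 0 < x^-1 by rewrite invr_gt0.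
have := ln_sub1 x0; have := ln_sub1 y0; rewrite lnV ?posrE// => h1 h2.
by rewrite ler_norml; apply/andP; split; lra.
Qed.

Lemma harmonic_number_deviation n c : (0 < n)%N -> (0 < c)%N ->
  `|harmonic_number c - 2^-1 * ln n%:R| <=
    3 / 2 + c%:R / Num.sqrt n.+1%:R + Num.sqrt n.+1%:R / c%:R.
Proof.
move=> n0 c0; set s := Num.sqrt n.+1%:R; have s0 : 0 < s by rewrite sqrtr_gt0
  ltr0n.
have cR : 0 < c%:R :> R by rewrite ltr0n.
have nR : 0 < n%:R :> R by rewrite ltr0n.
have /andP[h1 h2] := harmonic_number_ln c0.
have lns : ln s = 2^-1 * ln n.+1%:R.
  have : ln (s ^+ 2) = ln n.+1%:R by rewrite sqr_sqrtr.
  by rewrite lnXn// mulr2n => <-; lra.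
have := normr_ln_le (divr_gt0 cR s0); rewrite ln_div ?posrE// invf_div.
rewrite ler_norml => /andP[h3 h4].
have h5 : ln n%:R <= ln n.+1%:R :> R by rewrite ler_ln ?posrE ?ltr0n// ler_nat.
have h6 : ln n.+1%:R <= ln n%:R + 1 :> R.
  rewrite -lerBlDl -ln_div ?posrE ?ltr0n//.
  apply: le_trans (ln_sub1 _) _; first by rewrite divr_gt0.
  rewrite -natr1 mulrDl divff ?gt_eqF// addrC addKr div1r.
  by rewrite invf_le1// ler1n.
by rewrite ler_norml; apply/andP; split; lra.
Qed.

(** The logarithm of [c / sqrt n.+1] is bounded by that ratio plus its inverse,
    and both have bounded means. *)
Lemma core_log_deviation n : (0 < n)%N ->
  \sum_(c < n.+1) core_weight R n c * `|harmonic_number c - 2^-1 * ln n%:R| <=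
    6.
Proof.
move=> n0; set s : R := Num.sqrt n.+1%:R.
have s0 : 0 < s by rewrite sqrtr_gt0 ltr0n.
apply: le_trans (_ : \sum_(c < n.+1) (core_weight R n c * (3 / 2) +
  core_weight R n c * c%:R / s + core_weight R n c * (s / c%:R)) <= _).
  apply: ler_sum => -[[|c] cn] _ /=.
    by rewrite core_weight0// !mul0r !add0r.
  rewrite -mulrA -!mulrDr ler_wpM2l ?core_weight_ge0//.
  exact: harmonic_number_deviation.
rewrite !big_split/= -!mulr_suml sum_core_weight//.
have := core_inverse_mean_le R n0; rewrite -/s.
have : (\sum_(c < n.+1) core_weight R n c * c%:R) / s <= 3 / 2.
  by rewrite ler_pdivrMr// core_mean_le.
lra.
Qed.
End Harmonic.

(** * Approximate Stein identity *)

Section DiscreteStein.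
Variable R : realType.
Implicit Types (g h : nat -> R).

Lemma eq_ecycles c g h : g =1 h -> ecycles c g = ecycles c h.
Proof.
elim: c g h => [|c IH] g h gh /=; first exact: gh.
by rewrite (IH _ _ gh) (IH (g \o succn) (h \o succn))// => k; exact: gh.
Qed.

Lemma ecyclesD c g h :
  ecycles c (fun k => g k + h k) = ecycles c g + ecycles c h.
Proof.
elim: c g h => [//|c IH] g h /=; rewrite IH -mulrDl; congr (_ / _).
by rewrite (IH (g \o succn) (h \o succn)) mulrDr addrACA.
Qed.

Lemma ecyclesZ c (a : R) g : ecycles c (fun k => a * g k) = a * ecycles c g.
Proof.
elim: c g => [//|c IH] g /=; rewrite IH (IH (g \o succn)).
by rewrite mulrCA -mulrDr mulrA.
Qed.

Lemma ler_ecycles c g h : (forall k, g k <= h k) -> ecycles c g <= ecycles c h.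
Proof.
elim: c g h => [|c IH] g h gh /=; first exact: gh.
rewrite ler_pM2r ?invr_gt0 ?ltr0n// lerD//.
  by rewrite ler_wpM2l// IH.
by apply: IH => k; exact: gh.
Qed.

Lemma ecycles_cst c (a : R) : ecycles c (fun=> a) = a.
Proof.
elim: c => [//|c IH] /=.
have -> : (fun _ : nat => a) \o succn = (fun=> a) by [].
by rewrite IH -[X in _ + X]mul1r -mulrDl natr1 mulrAC divff ?mul1r// pnatr_eq0.
Qed.

Lemma normr_ecycles_le c g (B : R) : (forall k, `|g k| <= B) -> `|ecycles c g|
  <= B.
Proof.
move=> gB; rewrite ler_norml; apply/andP; split.
  rewrite -[X in X <= _](ecycles_cst c); apply: ler_ecycles => k.
  by have := gB k; rewrite ler_norml => /andP[].
rewrite -[X in _ <= X](ecycles_cst c); apply: ler_ecycles => k.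
by have := gB k; rewrite ler_norml => /andP[].
Qed.

(** The number of cycles is a sum of independent Bernoulli variables of
    parameters [p_i = i^-1].  Size-biasing adds a cycle at an index [i] chosen
    proportionally to [p_i], and replacing the [i]-th variable by [1] instead of
    adding [1] changes the argument of [g] only with probability [p_i], whence
    the sum of the [p_i ^+ 2].  The proof follows the insertion recursion. *)
Lemma ecycles_size_bias c g (D : R) : (forall k, `|g k.+1 - g k| <= D) ->
  `|ecycles c (fun k => k%:R * g k) - harmonic_number R c * ecycles c
    (g \o succn)|
    <= D * \sum_(i < c) i.+1%:R ^- 2.
Proof.
elim: c g => [|c IH] g gD.
  by rewrite /harmonic_number !big_ord0 /= !mul0r subr0 normr0 mulr0.
set p : R := c.+1%:R^-1.
have c0 : c.+1%:R != 0 :> R by rewrite pnatr_eq0.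
have p0 : 0 < p by rewrite invr_gt0.
have gS k : `|(g \o succn) k.+1 - (g \o succn) k| <= D by exact: gD.
set A := fun g => ecycles c (fun k => k%:R * g k) - harmonic_number R c
  * ecycles c (g \o succn).
have -> : ecycles c.+1 (fun k => k%:R * g k) -
          harmonic_number R c.+1 * ecycles c.+1 (g \o succn) =
    p * (c%:R * A g + A (g \o succn)) +
    p ^+ 2 * ecycles c (fun k => g k.+1 - g k.+2).
  have -> : harmonic_number R c.+1 = harmonic_number R c + p by rewrite
    /harmonic_number big_ord_recr.
  rewrite /A /= (ecyclesD c (fun k => g k.+1) (fun k => - g k.+2)).
  rewrite (@eq_ecycles c (fun k => - g k.+2) (fun k => -1 * g k.+2));
    last first.
    by move=> k; rewrite mulN1r.
  rewrite ecyclesZ.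
  rewrite (@eq_ecycles c ((fun k => k%:R * g k) \o succn)
    (fun k => k%:R * g k.+1 + g k.+1)); last first.
    by move=> k; rewrite /= -natr1 mulrDl mul1r.
  rewrite ecyclesD -/p.
  have -> : (fun k => g k.+1) = g \o succn by [].
  have -> : (fun k => g k.+2) = g \o succn \o succn by [].
  have -> : c%:R = p^-1 - 1 :> R by rewrite /p invrK -natr1 addrK.
  by field; rewrite gt_eqF.
apply: le_trans (ler_normD _ _) _.
have B : `|p ^+ 2 * ecycles c (fun k => g k.+1 - g k.+2)| <= p ^+ 2 * D.
  rewrite normrM (ger0_norm (sqr_ge0 _)) ler_pM2l ?exprn_gt0//.
  by apply: normr_ecycles_le => k; rewrite distrC.
have B2 : `|p * (c%:R * A g + A (g \o succn))| <= D * \sum_(i < c) i.+1%:R ^- 2.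
  rewrite normrM gtr0_norm// mulrC ler_pdivrMr ?ltr0n//.
  apply: le_trans (ler_normD _ _) _; rewrite normrM normr_nat.
  have := IH _ gD; have := IH _ gS; rewrite -/(A _) -/(A _) => h1 h2.
  rewrite -natr1 mulrDr mulr1 lerD// mulrC ler_wpM2r//.
apply: le_trans (lerD B2 B) _.
by rewrite big_ord_recr/= mulrDr -exprVn [p ^+ 2 * D]mulrC.
Qed.

Lemma sum_inverse_squares_le c : \sum_(i < c) i.+1%:R ^- 2 <= 2 :> R.
Proof.
case: c => [|c]; first by rewrite big_ord0.
apply: le_trans (_ : 2 - c.+1%:R^-1 <= _); last first.
  by rewrite gerBl invr_ge0.
elim: c => [|c IH]; first by rewrite big_ord1 expr1n invr1; lra.
rewrite big_ord_recr/=; apply: le_trans (lerD IH (lexx _)) _.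
rewrite -subr_ge0 -(natr1 c.+1).
have : 0 < c.+1%:R :> R by rewrite ltr0n.
move: (c.+1%:R : R) => x x0.
have -> : 2 - (x + 1)^-1 - (2 - x^-1 + (x + 1) ^- 2) = x^-1 * (x + 1) ^- 2.
  by field; rewrite !gt_eqF//; lra.
by rewrite mulr_ge0// invr_ge0 ?sqr_ge0// ltW.
Qed.

Variable n : nat.
Hypothesis n_gt0 : (0 < n)%N.

(** The mean of [g] at the number of cycles of a uniform parking function. *)
Definition eparking (g : nat -> R) := \sum_(c < n.+1) core_weight R n c
  * ecycles c g.

Lemma eq_eparking g h : g =1 h -> eparking g = eparking h.
Proof. by move=> gh; apply: eq_bigr => c _; rewrite (eq_ecycles _ gh). Qed.

Lemma eparkingD g h : eparking (fun k => g k + h k) = eparking g + eparking h.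
Proof.
by rewrite /eparking -big_split; apply: eq_bigr => c _; rewrite ecyclesD mulrDr.
Qed.

Lemma eparkingZ (a : R) g : eparking (fun k => a * g k) = a * eparking g.
Proof.
by rewrite /eparking mulr_sumr; apply: eq_bigr => c _; rewrite ecyclesZ mulrCA.
Qed.

Lemma eparkingB g h : eparking (fun k => g k - h k) = eparking g - eparking h.
Proof.
rewrite -[- eparking h]mulN1r -eparkingZ -eparkingD.
by apply: eq_eparking => k; rewrite mulN1r.
Qed.

Lemma ler_eparking g h : (forall k, g k <= h k) -> eparking g <= eparking h.
Proof.
move=> gh; apply: ler_sum => c _.
by rewrite ler_wpM2l ?core_weight_ge0 ?leq_ord//; exact: ler_ecycles.
Qed.

Lemma eparking_cst (a : R) : eparking (fun=> a) = a.
Proof.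
rewrite /eparking; under eq_bigr do rewrite ecycles_cst.
by rewrite -mulr_suml sum_core_weight mul1r.
Qed.

Lemma normr_eparking_le g (B : R) : (forall k, `|g k| <= B) -> `|eparking g| <=
  B.
Proof.
move=> gB; rewrite ler_norml; apply/andP; split.
  rewrite -[X in X <= _]eparking_cst; apply: ler_eparking => k.
  by have := gB k; rewrite ler_norml => /andP[].
rewrite -[X in _ <= X]eparking_cst; apply: ler_eparking => k.
by have := gB k; rewrite ler_norml => /andP[].
Qed.

(** The harmonic numbers of the mixture are replaced by [2^-1 * ln n%:R] at the
    cost of a constant. *)
Lemma eparking_size_bias g (B D : R) :
  (forall k, `|g k| <= B) -> (forall k, `|g k.+1 - g k| <= D) ->
  `|eparking (fun k => k%:R * g k) - 2^-1 * ln n%:R * eparking (g \o succn)|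
    <= 2 * D + 6 * B.
Proof.
move=> gB gD.
have D0 : 0 <= D by exact: le_trans (gD 0%N).
have B0 : 0 <= B by exact: le_trans (gB 0%N).
set mu := 2^-1 * ln n%:R.
rewrite /eparking mulr_sumr -sumrB; apply: le_trans (ler_norm_sum _ _ _) _.
apply: le_trans (_ : \sum_(c < n.+1) (core_weight R n c * (2 * D) +
    core_weight R n c * `|harmonic_number R c - mu| * B) <= _); last first.
  rewrite big_split/= -!mulr_suml sum_core_weight// mul1r lerD2l ler_wpM2r//.
  exact: core_log_deviation.
apply: ler_sum => c _.
rewrite mulrCA -mulrBr normrM [X in X * _]ger0_norm ?core_weight_ge0 ?leq_ord//.
rewrite -mulrA -mulrDr ler_wpM2l ?core_weight_ge0 ?leq_ord//.
have -> : ecycles c (fun k => k%:R * g k) - mu * ecycles c (g \o succn) =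
    (ecycles c (fun k => k%:R * g k) - harmonic_number R c * ecycles c
      (g \o succn)) +
    (harmonic_number R c - mu) * ecycles c (g \o succn) by ring.
apply: le_trans (ler_normD _ _) _; apply: lerD.
  apply: le_trans (ecycles_size_bias _ gD) _.
  by rewrite mulrC ler_wpM2r// sum_inverse_squares_le.
by rewrite normrM ler_wpM2l//; apply: normr_ecycles_le => k; exact: gB.
Qed.

Section Normalized.
Hypothesis n_gt1 : (1 < n)%N.
Let mu : R := 2^-1 * ln n%:R.
Let sigma : R := Num.sqrt mu.

Definition standardized (k : nat) : R :=
  (k%:R - 2^-1 * ln n%:R) / Num.sqrt (2^-1 * ln n%:R).

Lemma half_ln_gt0 : 0 < 2^-1 * ln n%:R :> R.
Proof. by rewrite mulr_gt0 ?invr_gt0// ln_gt0// ltr1n. Qed.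

Let sigma_gt0 : 0 < sigma.
Proof. by rewrite sqrtr_gt0 half_ln_gt0. Qed.

Let sigma2 : sigma ^+ 2 = mu.
Proof. by rewrite sqr_sqrtr// ltW// half_ln_gt0. Qed.

Lemma standardizedS k : standardized k.+1 = standardized k + sigma^-1.
Proof. by rewrite /standardized -/mu -/sigma -natr1; field; rewrite gt_eqF. Qed.

(** Multiplication by [k] shifts the argument by one unit, that is by
    [sigma^-1] on the standardized scale; the centering and the squared
    scale are both [mu], so the shift becomes a difference quotient. *)
Lemma eparking_stein (F : R -> R) (B L : R) :
  (forall x, `|F x| <= B) -> (forall x y, `|F x - F y| <= L * `|x - y|) ->
  `|eparking (fun k => standardized k * F (standardized k)) -
    sigma * eparking (fun k => F (standardized k + sigma^-1) - F
      (standardized k))|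
  <= (2 * (L / sigma) + 6 * B) / sigma.
Proof.
move=> FB FL; pose g k := F (standardized k).
have gD k : `|g k.+1 - g k| <= L / sigma.
  apply: le_trans (FL _ _) _; rewrite standardizedS addrAC subrr add0r.
  by rewrite gtr0_norm// invr_gt0.
have := eparking_size_bias (fun k => FB (standardized k)) gD.
rewrite -/mu => H.
have E : (fun k => standardized k * F (standardized k)) =1
    (fun k => sigma^-1 * (k%:R * g k - mu * g k)).
  by move=> k; rewrite /g {1}/standardized -/mu -/sigma; ring.
rewrite (eq_eparking E) eparkingZ (eparkingB _ (fun k => mu * g k)) eparkingZ.
rewrite (eparkingB _ g).
have -> : eparking (fun k => F (standardized k + sigma^-1)) = eparking
  (g \o succn).
  by apply: eq_eparking => k; rewrite /g /= standardizedS.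
set e1 := eparking _; set e2 := eparking _; set e3 := eparking _.
have -> : sigma^-1 * (e1 - mu * e2) - sigma * (e3 - e2) = (e1 - mu * e3) /
  sigma.
  by rewrite -sigma2; field; rewrite gt_eqF.
by rewrite normrM [X in _ * X]gtr0_norm ?invr_gt0// ler_pM2r ?invr_gt0.
Qed.

(** Apply the approximate Stein identity to the identity function clipped to
    [[- M, M]]: its increments are at most those of the identity, while
    [x * F x] is nonnegative, and at least [M ^+ 2] as soon as [M <= `|x|]. *)
Lemma eparking_tight (M : R) : 0 < M ->
  eparking (fun k => (M <= `|standardized k|)%R%:R) <=
  (1 + (2 / sigma + 6 * M) / sigma) / M ^+ 2.
Proof.
move=> M0; pose F x : R := Num.min M (Num.max (- M) x).
have FB x : `|F x| <= M.
  rewrite /F ler_norml; case: (leP (- M) x) => h1.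
    by case: (leP M x) => h2; apply/andP; split; lra.
  by case: (leP M (- M)) => h2; apply/andP; split; lra.
have Fmono x y : x <= y -> F x <= F y <= F x + (y - x).
  rewrite /F => xy; case: (leP (- M) x) => h1; case: (leP (- M) y) => h2;
   try (case: (leP M x) => h3); try (case: (leP M y) => h4);
   try (case: (leP M (- M)) => h5); apply/andP; split; lra.
have FL x y : `|F x - F y| <= 1 * `|x - y|.
  rewrite mul1r; wlog xy : x y / x <= y.
    by move=> H; case: (leP x y) => [|/ltW] /H//;
      rewrite distrC [`|x - y|]distrC.
  have /andP[h1 h2] := Fmono _ _ xy.
  by rewrite !ler0_norm ?subr_le0//; lra.
have := eparking_stein FB FL; rewrite mul1r ler_norml => /andP[_].
rewrite lerBlDl => H.
rewrite ler_pdivlMr ?exprn_gt0// mulrC -eparkingZ.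
apply: le_trans (_ : eparking (fun k => standardized k * F (standardized k)) <=
  _).
  apply: ler_eparking => k; move: (standardized k) => x.
  have [h|h] := leP M `|x|; last first.
    rewrite mulr0 /F; move: h; rewrite ltr_norml => /andP[h1 h2].
    rewrite (max_idPr (ltW h1)) (min_idPr (ltW h2)).
    by rewrite -expr2 sqr_ge0.
  rewrite mulr1 /F; move: h; rewrite ler_normr => /orP[h|h].
    rewrite (max_idPr _); last by lra.
    by rewrite (min_idPl _)// expr2 ler_pM2r.
  rewrite (max_idPl _); last by lra.
  rewrite (min_idPr _); last by lra.
  rewrite expr2; nra.
apply: le_trans H _; rewrite lerD2r.
apply: le_trans (_ : sigma * eparking (fun=> sigma^-1) <= _).
  rewrite ler_pM2l//; apply: ler_eparking => k.
  have /andP[_] := @Fmono (standardized k) (standardized k + sigma^-1)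
    (ltac:(by rewrite lerDl invr_ge0 ltW)).
  lra.
by rewrite eparking_cst divff// gt_eqF.
Qed.

(** If [F] has derivative [x * F x + q x], with quadratic error, the difference
    quotient of step [sigma^-1] in the Stein identity is this derivative and
    the terms [x * F x] cancel. *)
Lemma eparking_stein_equation (F q : R -> R) (B L C : R) :
  (forall x, `|F x| <= B) -> (forall x y, `|F x - F y| <= L * `|x - y|) ->
  (forall x e, 0 < e -> `|F (x + e) - F x - e * (x * F x + q x)| <= C * e ^+ 2)
    ->
  `|eparking (fun k => q (standardized k))| <= (C + 2 * (L / sigma) + 6 * B) /
    sigma.
Proof.
move=> FB FL FC.
have := eparking_stein FB FL.
set e1 := eparking _; set e2 := eparking _ => H1.
have H2 : `|sigma * e2 - e1 - eparking (fun k => q (standardized k))| <=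
  C / sigma.
  rewrite /e2 -eparkingZ -!eparkingB; apply: normr_eparking_le => k.
  move: (standardized k) => x.
  have si : 0 < sigma^-1 by rewrite invr_gt0.
  have := FC x _ si; rewrite -(ler_pM2l sigma_gt0).
  rewrite -{1}(gtr0_norm sigma_gt0) -normrM.
  congr (`|_| <= _); field; rewrite ?gt_eqF//.
apply: le_trans (_ : `|e1 - sigma * e2| + `|sigma * e2 - e1 -
  eparking (fun k => q (standardized k))| <= _).
  set e3 := eparking _.
  have -> : `|e3| = `|(e1 - sigma * e2) + (sigma * e2 - e1 - e3)|.
    by rewrite -normrN; congr `|_|; ring.
  exact: ler_normD.
by apply: le_trans (lerD H1 H2) _; rewrite -mulrDl addrC addrA.
Qed.

End Normalized.
End DiscreteStein.

Local Open Scope classical_set_scope.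

(** * Solution of Stein's equation *)

Section SteinEquation.
Variable R : realType.
Notation leb := (@lebesgue_measure R).
Local Notation phi := (@normal_pdf R 0 1).

Lemma lipschitz_continuous (q : R -> R) (L : R) :
  (forall x y, `|q x - q y| <= L * `|x - y|) -> continuous q.
Proof.
move=> qL x; apply/cvgrPdist_le => e e0.
have L0 : 0 < `|L| + 1 by rewrite ltr_wpDl.
near=> y; apply: le_trans (qL _ _) _.
apply: le_trans (_ : (`|L| + 1) * `|x - y| <= _).
  by rewrite ler_wpM2r// (le_trans (ler_norm _))// lerDl.
rewrite mulrC -ler_pdivlMr//; near: y.
apply: cvgr_dist_le; first exact: cvg_id.
by rewrite divr_gt0.
Unshelve. all: by end_near. Qed.

Lemma normal_pdf01E x : phi x = normal_peak 1 * expR (- (x ^+ 2 / 2)).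
Proof.
by rewrite normal_pdfE ?oner_neq0// /normal_fun subr0 expr1n mulr2n mulNr.
Qed.

Lemma integrable_bounded_normal (q : R -> R) (B : R) : continuous q ->
  (forall x, `|q x| <= B) -> leb.-integrable setT
    (EFin \o (fun x => q x * phi x)).
Proof.
move=> qc qB.
have B0 : 0 <= B by exact: le_trans (qB 0).
apply: (@le_integrable _ _ _ leb _ measurableT _ (fun x => (B * phi x)%:E)).
- apply/measurable_EFinP; apply: measurable_funM;
  last exact: measurable_normal_pdf.
  exact: continuous_measurable_fun.
- move=> x _; rewrite /= lee_fin !normrM.
  by rewrite ler_wpM2r// (le_trans (qB x))// ler_norm.
- under eq_fun do rewrite EFinM.
  by apply: integrableZl => //; exact: integrable_normal_pdf.
Qed.

Section Solution.
Variables (q : R -> R) (K Lq : R).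
Hypotheses (K_gt0 : 0 < K) (qL : forall x y, `|q x - q y| <= Lq * `|x - y|).
Hypothesis (q0 : forall x, K <= `|x| -> q x = 0).
Hypothesis (qphi : (\int[leb]_x (q x * phi x))%R = 0).

Let Lq0 : 0 <= Lq.
Proof.
by have := qL 0 1; rewrite sub0r normrN normr1 mulr1; exact: le_trans.
Qed.

Let qc : continuous q. Proof. exact: lipschitz_continuous qL. Qed.

Let qB x : `|q x| <= Lq * (2 * K).
Proof.
have [h|h] := leP K `|x|.
  by rewrite q0// normr0 !mulr_ge0// ltW.
have qK : q K = 0 by rewrite q0// ger0_norm// ltW.
rewrite -[q x]subr0 -qK; apply: le_trans (qL _ _) _; rewrite ler_wpM2l//.
move: h; rewrite ltr_norml ler_norml => /andP[? ?]; apply/andP; split; lra.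
Qed.

(* The solution is [F = I / phi]: by [phi' x = - x * phi x] its derivative is
   [x * F x + q x], and it vanishes on both sides of the support of [q] because
   the whole integral is 0. *)
Let I (w : R) := (\int[leb]_(t in `]-oo, w]) (q t * phi t))%R.

Let I_derive (w : R) : is_derive w 1 I (q w * phi w).
Proof.
have ww : w < w + 1 by rewrite ltrDl.
have hi : leb.-integrable `]-oo, (w + 1)] (EFin \o (fun t => q t * phi t)).
  by apply: integrableS (integrable_bounded_normal qc qB).
have hc : {for w, continuous (fun t => q t * phi t)}.
  by apply: cvgM; [exact: qc|exact: continuous_normal_pdf (oner_neq0 _) _].
have [|dI EI] := continuous_FTC1 ww hi _ hc; first by rewrite ltNyr.
by apply: DeriveDef => //; rewrite -derive1E.
Qed.

Let I0 w : K <= `|w| -> I w = 0.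
Proof.
rewrite ler_normr => /orP[Kw|wK].
  rewrite /I Rintegral_mkcond -[RHS]qphi; apply: eq_Rintegral => t _.
  rewrite patchE; case: ifPn => //; rewrite notin_setE/= in_itv/= => /negP.
  by rewrite -ltNge => wt; rewrite q0 ?mul0r// ler_normr
    (ltW (le_lt_trans Kw wt)).
rewrite /I (@eq_Rintegral _ _ _ _ _ (cst 0)); first by rewrite Rintegral_cst//
  mul0r.
move=> t; rewrite inE/= in_itv/= => tw.
rewrite q0 ?mul0r// ler_normr; apply/orP; right.
by apply: le_trans wK _; rewrite lerN2.
Qed.

Let F (x : R) : R := (normal_peak 1)^-1 * (expR (x ^+ 2 / 2) * I x).

Let F0 x : K <= `|x| -> F x = 0.
Proof. by move=> h; rewrite /F I0// !mulr0. Qed.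

Let F_derive (x : R) : is_derive x 1 F (x * F x + q x).
Proof.
have dI := I_derive x.
have d2 : is_derive x 1 (fun x : R => x ^+ 2 / 2) x.
  by apply: is_derive_eq; rewrite /GRing.scale/=; field.
have dE : is_derive x 1 (fun x : R => expR (x ^+ 2 / 2))
  (x * expR (x ^+ 2 / 2)).
  apply: is_derive_eq.
  by rewrite /GRing.scale/=; field.
have dF := is_deriveZ (normal_peak 1 : R)^-1 (is_deriveM dE dI).
apply: is_derive_eq.
rewrite /GRing.scale/= /F normal_pdf01E expRN.
have e0 : expR (x ^+ 2 / 2) != 0 :> R by rewrite gt_eqF// expR_gt0.
have p0 : normal_peak (1 : R) != 0 by rewrite gt_eqF// normal_peak_gt0//
  oner_neq0.
by move: (expR _) e0 (normal_peak _) p0 => E e0 p p0; field; rewrite e0 p0.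
Qed.

(** The solution is supported in [[- K, K]], so it is bounded by compactness.
    Then [G x = x * F x + q x], its derivative, is bounded, hence [F] is
    Lipschitz, hence so is [G], and the mean value theorem controls the
    first-order expansion. *)
Lemma stein_solution : exists F B L C,
  [/\ forall x, `|F x| <= B,
      forall x y, `|F x - F y| <= L * `|x - y| &
      forall x e, 0 < e -> `|F (x + e) - F x - e * (x * F x + q x)| <=
        C * e ^+ 2].
Proof.
have Fd (x : R) : derivable F x 1 by case: (F_derive x).
have Fc : continuous F.
  by move=> x; apply: differentiable_continuous; apply/derivable1_diffP.
have [c _ cmax] : exists2 c, c \in `[- K, K]%R &
    forall t, t \in `[- K, K]%R -> `|F t| <= `|F c|.
  apply: (@EVT_max R (fun x => `|F x|) (- K) K); first by rewrite ge0_cp// ltW.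
  apply: continuous_subspaceT => x.
  by apply: continuous_comp; [exact: Fc|exact: norm_continuous].
set B := `|F c|; have B0 : 0 <= B by exact: normr_ge0.
have FB x : `|F x| <= B.
  have [h|h] := leP K `|x|; first by rewrite F0// normr0.
  by apply: cmax; rewrite in_itv/=; rewrite -ler_norml ltW.
pose G x := x * F x + q x.
pose L := K * B + Lq * (2 * K).
have L0 : 0 <= L by rewrite addr_ge0 ?mulr_ge0// ltW.
have GL x : `|G x| <= L.
  have [h|h] := leP K `|x|; first by rewrite /G F0// q0// mulr0 addr0 normr0.
  apply: le_trans (ler_normD _ _) _; apply: lerD => //.
  by rewrite normrM ler_pM// ltW.
have mvt x e : 0 < e -> exists2 y, x < y < x + e & F (x + e) - F x = G y * e.
  move=> e0; have [||y] := @MVT R F G x (x + e) _ _ (continuous_subspaceT Fc).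
  - by rewrite ltrDl.
  - by move=> y _; exact: F_derive.
  - by rewrite in_itv/= => yx ->; exists y => //; rewrite addrAC subrr add0r.
have FL x y : `|F x - F y| <= L * `|x - y|.
  wlog xy : x y / x < y.
    move=> H; case: (ltgtP x y) => [/H//|/H|->].
      by rewrite distrC [`|y - x|]distrC.
    by rewrite !subrr normr0 mulr0.
  have [|z _] := mvt x (y - x); first by rewrite subr_gt0.
  rewrite [x + (y - x)]addrC subrK => E;
    rewrite distrC E normrM [`|x - y|]distrC.
  by rewrite ler_wpM2r.
pose C := K * L + B + Lq.
have GC x y : `|G x - G y| <= C * `|x - y|.
  (* At most one of the two points has to be in the support: exchange them if
     necessary. *)
  have inner a b : `|a| <= K -> `|a * F a - b * F b| <= (K * L + B) * `|a - b|.
    move=> aK; have -> : a * F a - b * F b = a * (F a - F b) + (a - b) * F b by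
      ring.
    apply: le_trans (ler_normD _ _) _; rewrite [leRHS]mulrDl; apply: lerD.
      by rewrite normrM -mulrA ler_pM.
    by rewrite normrM mulrC ler_wpM2r.
  have -> : G x - G y = (x * F x - y * F y) + (q x - q y) by rewrite /G; ring.
  apply: le_trans (ler_normD _ _) _; rewrite mulrDl; apply: lerD => //.
  have [xK|/ltW xK] := leP `|x| K; first exact: inner.
  have [yK|/ltW yK] := leP `|y| K.
    by rewrite distrC [`|x - y|]distrC; exact: inner.
  by rewrite !F0// !mulr0 subrr normr0 !mulr_ge0// addr_ge0// mulr_ge0// ltW.
exists F, B, L, C; split => // x e e0.
have [y /andP[xy yx] ->] := mvt x e e0.
rewrite mulrC -mulrBr normrM (gtr0_norm e0) expr2 mulrA mulrC ler_wpM2r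
  ?(ltW e0)//.
apply: le_trans (GC _ _) _; rewrite ler_wpM2l//.
  by rewrite !addr_ge0// mulr_ge0// ltW.
by rewrite gtr0_norm ?subr_gt0// lerBlDl ltW.
Qed.

End Solution.
End SteinEquation.

(** * Law of the random variables and test functions *)

Section Law.
Variables (R : realType) (d : measure_display) (T : measurableType d).
Variables (P : probability T R) (n : nat) (X : {RV P >-> parking n}).
Hypothesis X_unif : uniform_parking X.

Lemma parking_image f : (f \in @parking_fun n @: predT)%SET = is_parking f.
Proof.
apply/imsetP/idP => [[g _ ->]|fP]; first exact: parkingP.
by exists (Parking fP).
Qed.

Lemma card_parking : #|{: parking n}| = parking_inj_count
  (finset.set0 : {set 'I_n}).
Proof.
rewrite -(card_imset predT (val_inj : injective (@parking_fun n))).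
by apply: eq_card => f; rewrite parking_image [in RHS]inE imset0 cards0 andbT.
Qed.

(** The probability of [A] is a finite sum over its elements, to which the
    mixture representation applies. *)
Lemma uniform_parking_law (A : set (parking n)) (g : nat -> R) :
  (forall f : parking n, A f -> g (ncycles f) = 1) ->
  (forall f : parking n, ~ A f -> g (ncycles f) = 0) ->
  P (X @^-1` A) = (eparking n g)%:E.
Proof.
move=> gA gNA.
pose r := [seq f <- enum {: parking n} | `[< A f >]].
have rA : A = \bigcup_(f in [set` r]) [set f].
  apply/seteqP; split => [f Af|_ [f /= fr ->]].
    by exists f => //=; rewrite mem_filter mem_enum andbT; apply/asboolP.
  by move: fr; rewrite mem_filter => /andP[/asboolP].
have -> : P (X @^-1` A) = distribution P X A by [].
rewrite [in LHS]rA measure_fin_bigcup//; last first.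
  by apply/trivIsetP => f1 f2 _ _ f12; apply/seteqP;
    split => // f [/= ->] /eqP; rewrite (negbTE f12).
rewrite -fsbig_seq; last by rewrite filter_uniq// enum_uniq.
rewrite (eq_bigr (fun=> ((#|{: parking n}|%:R)^-1)%:E)); last by move=> f _;
  exact: X_unif.
rewrite sumEFin; congr EFin.
rewrite /r big_filter big_enum_cond/=.
have N0 : #|{: parking n}|%:R != 0 :> R.
  by rewrite pnatr_eq0 -lt0n; apply/card_gt0P;
    exists (Parking (is_parking_id n)).
apply: (mulfI N0); rewrite /eparking card_parking -sum_parking_ecycles
  -card_parking.
rewrite mulr_sumr.
transitivity (\sum_(f : parking n) g (ncycles f)).
  rewrite big_mkcond; apply: eq_bigr => f _.
  by case: ifPn => [/asboolP/gA ->|/asboolP/gNA ->//]; rewrite divff.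
rewrite -[LHS](big_imset (fun f : {ffun _} => g (ncycles f)))/=; last first.
  by move=> f1 f2 _ _; exact: val_inj.
by apply: eq_bigl => f; exact: parking_image.
Qed.
End Law.

Section Trapezoid.
Variable R : realType.
Variables (m r k : R).
Hypothesis k_gt0 : 0 < k.
(** The value is [1] on the ball of center [m] and radius [r - k^-1], and [0]
    outside the ball of radius [r]. *)
Definition trapezoid (x : R) := Num.min 1 (Num.max 0 (k * (r - `|x - m|))).

Lemma trapezoid_ge0 x : 0 <= trapezoid x.
Proof. by rewrite /trapezoid le_min ler01 le_max lexx. Qed.

Lemma trapezoid_le1 x : trapezoid x <= 1.
Proof. by rewrite /trapezoid ge_min lexx. Qed.

Lemma trapezoid_out x : r <= `|x - m| -> trapezoid x = 0.
Proof.
move=> h; rewrite /trapezoid (max_idPl _) ?(min_idPr _)//.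
by rewrite pmulr_rle0// subr_le0.
Qed.

Lemma trapezoid_in x : `|x - m| <= r - k^-1 -> trapezoid x = 1.
Proof.
move=> h; apply: min_idPl.
have : 1 <= k * (r - `|x - m|) by rewrite mulrC -ler_pdivrMr// div1r; lra.
by rewrite le_max => ->; rewrite orbT.
Qed.

Lemma trapezoid_lipschitz x y : `|trapezoid x - trapezoid y| <= k * `|x - y|.
Proof.
have : `|k * (r - `|x - m|) - k * (r - `|y - m|)| <= k * `|x - y|.
  rewrite -mulrBr normrM (gtr0_norm k_gt0) ler_pM2l//.
  rewrite (_ : r - `|x - m| - (r - `|y - m|) = `|y - m| - `|x - m|);
    last by ring.
  apply: le_trans (ler_dist_dist _ _) _.
  by rewrite opprB addrA subrK distrC.
rewrite /trapezoid; move: (k * (r - _)) (k * (r - _)) => a b.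
move: (k * `|x - y|) => z.
rewrite !ler_norml => /andP[h1 h2].
case: (leP 0 a) => ha; case: (leP 0 b) => hb; try (case: (leP 1 a) => ha');
  try (case: (leP 1 b) => hb'); try (case: (leP 1 0) => h0); apply/andP; split;
    lra.
Qed.
End Trapezoid.

(** * Mass of intervals in the limit *)

Section Limit.
Variable R : realType.
Notation leb := (@lebesgue_measure R).
Local Notation phi := (@normal_pdf R 0 1).
Local Notation W := (@standardized R).
Local Notation E := (@eparking R).

Lemma near_sigma_ge (A : R) :
  \forall n \near \oo, (1 < n)%N /\ A <= Num.sqrt (2^-1 * ln n%:R).
Proof.
near=> n; split; first by near: n; exact: nbhs_infty_gt.
apply: le_trans (_ : `|A| <= _); first exact: ler_norm.
rewrite -sqrtr_sqr ler_wsqrtr//.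
have : expR (2 * A ^+ 2) <= n%:R by near: n; exact: nbhs_infty_ger.
move=> h; have : ln (expR (2 * A ^+ 2)) <= ln (n%:R : R).
  by rewrite ler_ln ?posrE ?expR_gt0// (lt_le_trans _ h)// expR_gt0.
by rewrite expRK; lra.
Unshelve. all: by end_near. Qed.

(** The error terms of [eparking_stein_equation] are of order [sigma^-1]. *)
Lemma stein_limit (q : R -> R) (K Lq e : R) : 0 < K -> 0 < e ->
  (forall x y, `|q x - q y| <= Lq * `|x - y|) ->
  (forall x, K <= `|x| -> q x = 0) ->
  (\int[leb]_x (q x * phi x))%R = 0 ->
  \forall n \near \oo, `|E n (fun k => q (W n k))| <= e.
Proof.
move=> K0 e0 qL q0 qphi.
have [F [B [L [C [FB FL FC]]]]] := stein_solution K0 qL q0 qphi.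
have := near_sigma_ge (Num.max 1 ((`|C| + 2 * `|L| + 6 * `|B|) / e)).
apply: filterS => n [n1]; rewrite ge_max => /andP[s1 se].
have s0 := lt_le_trans (@ltr01 R) s1.
have := @eparking_stein_equation R n (ltnW n1) n1 F q B L C FB FL FC.
move=> /le_trans; apply; rewrite ler_pdivrMr//.
rewrite ler_pdivrMr// [_ * e]mulrC in se; apply: le_trans se.
apply: lerD; last by rewrite ler_wpM2l// ler_norm.
apply: lerD; first exact: ler_norm.
rewrite ler_wpM2l// ler_pdivrMr//; apply: le_trans (ler_norm _) _.
by rewrite ler_peMr.
Qed.

Lemma tight_limit (M : R) : 1 <= M ->
  \forall n \near \oo, E n (fun k => (M <= `|W n k|)%R%:R) <= 2 / M.
Proof.
move=> M1; have M0 := lt_le_trans (@ltr01 R) M1.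
have := near_sigma_ge (Num.max 1 (2 + 6 * M)).
apply: filterS => n [n1]; rewrite ge_max => /andP[s1 se].
have s0 := lt_le_trans (@ltr01 R) s1.
apply: le_trans (eparking_tight (ltnW n1) n1 M0) _.
rewrite ler_pdivrMr ?exprn_gt0// expr2 mulrA divfK ?gt_eqF//.
apply: le_trans (_ : 2 <= _); last by rewrite ler_peMr.
rewrite -[2]/(1 + 1 : R) lerD2l ler_pdivrMr// mul1r; apply: le_trans se.
by rewrite lerD2r ler_pdivrMr// ler_peMr.
Qed.

Lemma integrable_trapezoid (m r k : R) : 0 < k ->
  leb.-integrable setT (EFin \o (fun x => trapezoid m r k x * phi x)).
Proof.
move=> k0; apply: (@integrable_bounded_normal _ _ 1).
  exact: lipschitz_continuous (trapezoid_lipschitz m r k0).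
by move=> x; rewrite ger0_norm ?trapezoid_ge0// trapezoid_le1.
Qed.

Lemma trapezoid_mean_ge0 (m r k : R) :
  0 <= (\int[leb]_x (trapezoid m r k x * phi x))%R.
Proof.
by apply: Rintegral_ge0 => x _; rewrite mulr_ge0 ?trapezoid_ge0 ?normal_pdf_ge0.
Qed.

Lemma trapezoid_mean_le1 (m r k : R) : 0 < k ->
  (\int[leb]_x (trapezoid m r k x * phi x))%R <= 1.
Proof.
move=> k0; apply: le_trans (_ : (\int[leb]_x phi x)%R <= _); last first.
  by rewrite /Rintegral integral_normal_pdf.
apply: le_Rintegral => //; first exact: integrable_trapezoid.
  exact: integrable_normal_pdf.
by move=> x _; rewrite ler_piMl ?normal_pdf_ge0// trapezoid_le1.
Qed.

Lemma trapezoid_mean_ge (a b e : R) : 0 < e -> a <= b ->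
  fine (normal_prob 0 1 `[a, b]) <=
  (\int[leb]_x (trapezoid ((a + b) / 2) ((b - a) / 2 + e) e^-1 x * phi x))%R.
Proof.
move=> e0 ab; have ei : 0 < e^-1 by rewrite invr_gt0.
rewrite -[leLHS]/(\int[leb]_(x in `[a, b]) phi x)%R Rintegral_mkcond.
apply: le_Rintegral => //.
- have : leb.-integrable `[a, b] (EFin \o phi).
    by apply: integrableS (integrable_normal_pdf 0 1).
  by move=> /integrable_mkcond; rewrite restrict_EFin; apply.
- exact: integrable_trapezoid.
- move=> x _; rewrite patchE; case: ifPn => [|_]; last first.
    by rewrite mulr_ge0 ?trapezoid_ge0 ?normal_pdf_ge0.
  rewrite inE/= in_itv/= => /andP[ax xb].
  rewrite trapezoid_in ?mul1r//= invrK addrK.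
  by rewrite ler_norml; apply/andP; split; lra.
Qed.

(** Let [alpha] and [beta] be the normal means of a trapezoid [t1] on the
    interval and of a wide trapezoid [t2].  The combination
    [beta * t1 - alpha * t2] has normal mean 0, so its mean at [W] is small;
    since the mean of [t2] at [W] is close to 1 by tightness and [beta <= 1],
      the
    mean of [t1] is at least [alpha] up to a small error. *)
Lemma interval_lower_bound (a b dl e : R) : 0 < dl -> a <= b -> 0 < e ->
  \forall n \near \oo, fine (normal_prob 0 1 `[a, b]) - e <=
    E n (fun k => (a - dl < W n k < b + dl)%R%:R).
Proof.
move=> dl0 ab e0.
have di : 0 < dl^-1 by rewrite invr_gt0.
pose m := (a + b) / 2; pose r := (b - a) / 2 + dl.
(* By [tight_limit], [W] leaves [[- M, M]] with probability at most [e / 2]. *)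
pose M := Num.max 1 (4 / e).
have M1 : 1 <= M by rewrite /M le_max lexx.
have eM : 2 / M <= e / 2.
  have M0 := lt_le_trans (@ltr01 R) M1.
  rewrite ler_pdivrMr// -ler_pdivrMl ?divr_gt0//.
  rewrite /M le_max; apply/orP; right; rewrite le_eqVlt; apply/orP; left.
  by apply/eqP; field; rewrite gt_eqF.
pose t1 := trapezoid m r dl^-1.
pose t2 : R -> R := trapezoid 0 (M + 1) 1.
set al := fine _.
pose alpha := (\int[leb]_x (t1 x * phi x))%R.
pose beta := (\int[leb]_x (t2 x * phi x))%R.
have al_alpha : al <= alpha by exact: trapezoid_mean_ge.
have alpha0 : 0 <= alpha by exact: trapezoid_mean_ge0.
have beta0 : 0 <= beta by exact: trapezoid_mean_ge0.
have alpha1 : alpha <= 1 by exact: trapezoid_mean_le1.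
have beta1 : beta <= 1 by exact: trapezoid_mean_le1.
pose q x := beta * t1 x - alpha * t2 x.
have qL x y : `|q x - q y| <= (beta * dl^-1 + alpha) * `|x - y|.
  have -> : q x - q y = beta * (t1 x - t1 y) - alpha * (t2 x - t2 y).
    by rewrite /q; ring.
  apply: le_trans (ler_normB _ _) _; rewrite [leRHS]mulrDl.
  rewrite !normrM (ger0_norm alpha0) (ger0_norm beta0).
  apply: lerD; rewrite -?mulrA ler_wpM2l//.
    exact: trapezoid_lipschitz.
  by rewrite -[leRHS]mul1r; exact: trapezoid_lipschitz.
pose K := `|m| + `|r| + (M + 1).
have K0 : 0 < K by rewrite ltr_wpDl// ltr_wpDl// (le_trans _ M1).
have q0 x : K <= `|x| -> q x = 0.
  rewrite /K /q => Kx; rewrite /t1 /t2 !trapezoid_out ?mulr0 ?subrr//.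
    rewrite subr0; apply: le_trans Kx; rewrite lerDr addr_ge0//.
  apply: le_trans (ler_norm _) _.
  have := lerB_dist x m; move: (`|x|) (`|r|) (`|m|) `|x - m| Kx => x' r' m' xm;
    lra.
have qphi : (\int[leb]_x (q x * phi x))%R = 0.
  have i1 := integrable_trapezoid m r di.
  have i2 := integrable_trapezoid 0 (M + 1) (@ltr01 R).
  transitivity (\int[leb]_x (beta * (t1 x * phi x) - alpha * (t2 x * phi x)))%R.
    by apply: eq_Rintegral => x _; rewrite /q; ring.
  rewrite RintegralB//; first by rewrite !RintegralZl// mulrC subrr.
    by have := integrableZl measurableT beta i1.
  by have := integrableZl measurableT alpha i2.
have He2 : 0 < e / 2 by rewrite divr_gt0.
near=> n.
have n1 : (1 < n)%N by near: n; exact: nbhs_infty_gt.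
have n0 := ltnW n1.
have T : E n (fun k => (M <= `|W n k|)%R%:R) <= e / 2.
  by apply: le_trans eM; near: n; exact: tight_limit.
have : `|E n (fun k => q (W n k))| <= e / 2.
  by near: n; exact: stein_limit K0 He2 qL q0 qphi.
rewrite /q (eparkingB n (fun k => beta * t1 (W n k))
  (fun k => alpha * t2 (W n k))).
rewrite !eparkingZ ler_norml => /andP[H _].
have Et2 : 1 - e / 2 <= E n (fun k => t2 (W n k)).
  apply: le_trans (_ : 1 - E n (fun k => (M <= `|W n k|)%R%:R) <= _).
    by rewrite lerD2l lerN2.
  rewrite -[X in X - _](@eparking_cst R n 1) -eparkingB.
  apply: ler_eparking => // k; have [_|h] := leP M `|W n k|.
    by rewrite subrr trapezoid_ge0.
  by rewrite subr0 /t2 trapezoid_in// subr0 invr1 addrK ltW.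
have Et1 : E n (fun k => t1 (W n k)) <=
  E n (fun k => (a - dl < W n k < b + dl)%R%:R).
  apply: ler_eparking => // k; have [_|h] := boolP (a - dl < W n k < b + dl);
    first exact: trapezoid_le1.
  rewrite /t1 trapezoid_out//; move: h; rewrite negb_and -!leNgt /r /m
    ler_normr.
  by move=> /orP[h|h]; apply/orP; [right|left]; lra.
have Et1_0 : 0 <= E n (fun k => t1 (W n k)).
  rewrite -(@eparking_cst R n 0); apply: ler_eparking => // k.
  exact: trapezoid_ge0.
have h1 : alpha * (1 - e / 2) <= alpha * E n (fun k => t2 (W n k)) by rewrite
  ler_wpM2l.
have h2 : beta * E n (fun k => t1 (W n k)) <= E n (fun k => t1 (W n k)).
  by rewrite ler_piMl.
have h3 : alpha * (e / 2) <= e / 2 by rewrite ler_piMl// ltW.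
apply: le_trans Et1; apply: le_trans h2.
rewrite mulrBr mulr1 in h1; lra.
Unshelve. all: by end_near. Qed.

End Limit.

(** * Distribution functions *)

Section Exhaustion.
Variable R : realType.
Local Notation gauss := (@normal_prob R 0 1).

Lemma normal_prob_exhaustion (F : nat -> set (measurableTypeR R)) (e : R) :
  (forall k, measurable (F k)) -> nondecreasing_seq F -> 0 < e ->
  exists k, fine (gauss (\bigcup_k F k)) - e <= fine (gauss (F k)).
Proof.
move=> mF ndF e0; have mU : measurable (\bigcup_k F k) by
  exact: bigcup_measurable.
have fin A : measurable A -> gauss A \is a fin_num by move=> mA;
  exact: fin_num_measure.
have := nondecreasing_cvg_mu (mu := gauss) mF mU ndF.
rewrite -[X in _ --> X](fineK (fin _ mU)) => /fine_cvgP[_].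
move=> /cvgrPdist_le/(_ _ e0)[N _ /(_ N (leqnn N))] /= h.
by exists N; move: h; rewrite ler_norml => /andP[_]; lra.
Qed.

Lemma ltr_invSn (y : R) : 0 < y -> exists k : nat, k.+1%:R^-1 <= y.
Proof.
move=> y0; exists (Num.truncn y^-1); rewrite -[leRHS]invrK lef_pV2 ?posrE
  ?invr_gt0//.
by apply/ltW; rewrite Num.Theory.truncnS_gt.
Qed.

Let step k : 0 < k.+1%:R^-1 :> R. Proof. by rewrite invr_gt0. Qed.
Let step_mono i j : (i <= j)%N -> ((j.+1%:R : R)^-1 <= (i.+1%:R : R)^-1 <=
  (j.+1%:R : R)^-1 + (j%:R - i%:R)).
Proof.
move=> ij; rewrite lef_pV2 ?posrE// ler_nat ltnS ij/=.
move: ij; rewrite leq_eqVlt => /orP[/eqP ->|ij]; first by rewrite subrr addr0.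
apply: le_trans (_ : 1 <= _); first by rewrite invf_le1// ler1n.
apply: le_trans (_ : j%:R - i%:R <= _); last by rewrite lerDr ltW.
by rewrite -natrB ?(ltnW ij)// ler1n subn_gt0.
Qed.

(** The interval keeps a margin [dl] inside the half-line, to be used by the
    slopes of the trapezoid in [interval_lower_bound]. *)
Lemma exhaust_right (x e : R) : 0 < e ->
  exists a b dl : R, [/\ 0 < dl, a <= b, x <= a - dl &
    fine (gauss `]x, +oo[) - e <= fine (gauss `[a, b])].
Proof.
move=> e0.
pose F k : set (measurableTypeR R) := `[x + k.+1%:R^-1, x + k.+1%:R^-1
  + k%:R]%classic.
have mF k : measurable (F k) by exact: measurable_itv.
have ndF : nondecreasing_seq F.
  move=> i j ij; apply/subsetPset => y; rewrite /F/= !in_itv/= => /andP[h1 h2].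
  have /andP[h3 h4] := step_mono ij; apply/andP; split.
    by apply: le_trans h1; rewrite lerD2l.
  by apply: le_trans h2 _; rewrite -!addrA lerD2l -lerBrDr -addrA.
have [k] := normal_prob_exhaustion mF ndF e0.
rewrite (_ : \bigcup_k F k = `]x, +oo[%classic) => [h|].
  exists (x + k.+1%:R^-1), (x + k.+1%:R^-1 + k%:R), k.+1%:R^-1.
  by split => //; [rewrite lerDl|rewrite addrK].
apply/seteqP; split => [y [i _]|y]; rewrite /F/= !in_itv/= ?andbT.
  by move=> /andP[h _]; apply: lt_le_trans h; rewrite ltrDl.
move=> xy; have [i hi] := @ltr_invSn (y - x) ltac:(by rewrite subr_gt0).
exists (i + Num.truncn (y - x)).+1 => //=; rewrite in_itv/=.
have ij : (i <= (i + Num.truncn (y - x)).+1)%N by lia.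
have /andP[h3 _] := step_mono ij.
have h4 : y - x <= (i + Num.truncn (y - x)).+1%:R.
  apply: le_trans (_ : (Num.truncn (y - x)).+1%:R <= _);
    first by rewrite ltW// Num.Theory.truncnS_gt.
  by rewrite ler_nat; lia.
have := step (i + Num.truncn (y - x)).+1.
have aux (u v w z : R) : 0 < u -> u <= v -> v <= z - x -> z - x <= w ->
    x + u <= z <= x + u + w.
  by move=> *; apply/andP; split; lra.
by move=> h5; exact: aux h5 h3 hi h4.
Qed.

(** The intervals exhaust the open half-line, which has the same mass. *)
Lemma exhaust_left (x e : R) : 0 < e ->
  exists a b dl : R, [/\ 0 < dl, a <= b, b + dl <= x &
    fine (gauss `]-oo, x]) - e <= fine (gauss `[a, b])].
Proof.
move=> e0.
pose F k : set (measurableTypeR R) := `[x - k.+1%:R^-1 - k%:R, x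
  - k.+1%:R^-1]%classic.
have mF k : measurable (F k) by exact: measurable_itv.
have ndF : nondecreasing_seq F.
  move=> i j ij; apply/subsetPset => y; rewrite /F/= !in_itv/= => /andP[h1 h2].
  have /andP[h3 h4] := step_mono ij; apply/andP; split.
    by apply: le_trans h1; rewrite -!addrA lerD2l -!opprD lerN2 -lerBrDr -addrA.
  by apply: le_trans h2 _; rewrite lerD2l lerN2.
have [k] := normal_prob_exhaustion mF ndF e0.
rewrite (_ : \bigcup_k F k = `]-oo, x[%classic) => [|].
  have -> : fine (gauss `]-oo, x[) = fine (gauss `]-oo, x]).
    apply: Rintegral_itv_bndo_bndc.
    by apply: integrableS (integrable_normal_pdf 0 1).
  exists (x - k.+1%:R^-1 - k%:R), (x - k.+1%:R^-1), k.+1%:R^-1.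
  by split => //; [rewrite gerBl|rewrite subrK].
apply/seteqP; split => [y [i _]|y]; rewrite /F/= !in_itv/= ?andbT.
  by move=> /andP[_ h]; apply: le_lt_trans h _; rewrite gtrBl.
move=> xy; have [i hi] := @ltr_invSn (x - y) ltac:(by rewrite subr_gt0).
exists (i + Num.truncn (x - y)).+1 => //=; rewrite in_itv/=.
have ij : (i <= (i + Num.truncn (x - y)).+1)%N by lia.
have /andP[h3 _] := step_mono ij.
have h4 : x - y <= (i + Num.truncn (x - y)).+1%:R.
  apply: le_trans (_ : (Num.truncn (x - y)).+1%:R <= _);
    first by rewrite ltW// Num.Theory.truncnS_gt.
  by rewrite ler_nat; lia.
have := step (i + Num.truncn (x - y)).+1.
have aux (u v w z : R) : 0 < u -> u <= v -> v <= x - z -> x - z <= w ->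
    x - u - w <= z <= x - u.
  by move=> *; apply/andP; split; lra.
by move=> h5; exact: aux h5 h3 hi h4.
Qed.

(** The lower bounds on the two complementary half-lines are an upper and a
  lower
    bound on the distribution function. *)
Lemma eparking_cdf_cvg (x : R) :
  @eparking R n (fun k => (standardized R n k <= x)%R%:R) @[n --> \oo] -->
  fine (gauss `]-oo, x]).
Proof.
apply/cvgrPdist_le => e e0; have e20 : 0 < e / 2 by rewrite divr_gt0.
have [a [b [dl [dl0 ab bx hl]]]] := exhaust_left x e20.
have [a' [b' [dl' [dl0' ab' bx' hr]]]] := exhaust_right x e20.
near=> n.
have n0 : (0 < n)%N by near: n; exact: nbhs_infty_gt.
have H1 : fine (gauss `[a, b]) - e / 2 <=
    @eparking R n (fun k => (a - dl < standardized R n k < b + dl)%R%:R).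
  by near: n; exact: interval_lower_bound.
have H2 : fine (gauss `[a', b']) - e / 2 <=
    @eparking R n (fun k => (a' - dl' < standardized R n k < b' + dl')%R%:R).
  by near: n; exact: interval_lower_bound.
have K1 : @eparking R n (fun k => (a - dl < standardized R n k < b + dl)%R%:R)
  <=
    @eparking R n (fun k => (standardized R n k <= x)%R%:R).
  apply: ler_eparking => // k; rewrite ler_nat.
  have [/andP[_ h]|//] := boolP (a - dl < standardized R n k < b + dl).
  by rewrite (ltW (lt_le_trans h bx)).
have K2 : @eparking R n (fun k => (a' - dl' < standardized R n k < b'
  + dl')%R%:R) <=
    1 - @eparking R n (fun k => (standardized R n k <= x)%R%:R).
  rewrite -[X in _ <= X - _](@eparking_cst R n 1) -eparkingB.
  apply: ler_eparking => // k.
  have [/andP[h _]|_] := boolP (a' - dl' < standardized R n k < b' + dl').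
    by rewrite [standardized R n k <= x]leNgt (le_lt_trans bx' h) subr0.
  by case: (standardized R n k <= x); rewrite ?subrr ?subr0.
have C : fine (gauss `]x, +oo[) = 1 - fine (gauss `]-oo, x]).
  rewrite -setCitvl probability_setC// fineB//.
  exact: fin_num_measure.
by rewrite ler_norml; apply/andP; split; lra.
Unshelve. all: by end_near. Qed.
End Exhaustion.

Theorem theorem4p2 (R : realType) (d : nat -> measure_display)
    (T : forall n, measurableType (d n)) (P : forall n, probability (T n) R)
    (pi_ : forall n, {RV (P n) >-> parking n})
    (pi_unif : forall n, uniform_parking (pi_ n)) :
  cvg_in_distribution
    (fun n => (@normalized_ncycles R n \o pi_ n : {RV (P n) >-> R}))
    (normal_prob 0 1).
Proof.
move=> x _.
have fin : (normal_prob 0 1 `]-oo, x])%E \is a fin_num.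
  exact: fin_num_measure.
rewrite -[X in _ --> X](fineK fin).
rewrite [X in X @ _](_ : _ = fun n => 
  (@eparking R n (fun k => (standardized R n k <= x)%R%:R))%:E); last first.
  apply/funext => n; rewrite /cdf.
  have -> : distribution (P n) (@normalized_ncycles R n \o pi_ n) `]-oo, x] =
     P n (pi_ n @^-1` [set f : parking n | normalized_ncycles R f <= x]).
    congr (P n _); apply/seteqP; split => t /=; rewrite in_itv//=.
  rewrite (uniform_parking_law (pi_unif n)
    (g := fun k => (standardized R n k <= x)%R%:R)) // => f /=.
    by rewrite /normalized_ncycles /standardized => ->.
  by rewrite /normalized_ncycles /standardized => /negP/negbTE ->.
apply: cvg_EFin; first by near=> n.
exact: eparking_cdf_cvg.
Unshelve. all: by end_near. Qed.
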